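(* Let $G$ be a contact Carnot group and $p\in G$, $p\neq p_0$. The set $\Gamma(p)$ of geodesics from $p_0$ ending at $p$ can be decomposed into the disjoint union of two closed submanifolds $$\Gamma(p)=\Gamma_0(p)\cup\Gamma_\infty(p),$$ where $\Gamma_0(p)$ is finite and $\Gamma_\infty(p)$ is homeomorphic to a (disjoint, possibly empty or infinite) union of spheres. Moreover the energy function $J$ is constant on each connected component of $\Gamma(p)$.
   Context: A contact Carnot group $G$ is a connected, simply connected Lie group of dimension $2n+1$ whose Lie algebra of left-invariant vector fields splits as $\mathfrak g=\mathfrak g_1\oplus\mathfrak g_2$ with $\dim\mathfrak g_2=1$, $[\mathfrak g_1,\mathfrak g_1]=\mathfrak g_2$, $[\mathfrak g_1,\mathfrak g_2]=[\mathfrak g_2,\mathfrak g_2]=0$, with a scalar product on $\mathfrak g_1$ having orthonormal basis $f_1,\dots,f_{2n}$. Fix a generator $f_0$ of $\mathfrak g_2$; then $[f_i,f_j]=A_{ij}f_0$ for a skew-symmetric matrix $A$, which is required to be non-degenerate. $p_0$ denotes the identity of $G$. In exponential coordinates $p=(x,z)\in\mathbb{R}^{2n}\times\mathbb{R}$ means $p=\exp_G(\sum_i x_if_i+zf_0)$. Let $0<\alpha_1<\dots<\alpha_k$ be the distinct singular values of $A$; $x_j$ denotes the projection of $x$ on the invariant subspace of $\alpha_j$ (of dimension $2n_j$). A geodesic is a non-constant Lipschitz curve $\gamma:[0,1]\to G$, tangent a.e. to $\mathfrak g_1$, locally minimizing the energy $J(\gamma)=\frac12\int_0^1\|\dot\gamma\|^2dt$.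 Geodesics starting from $p_0$ are parametrized by their initial covector: with the Hamiltonian $H(\eta)=\frac12\sum_{i=1}^{2n}\langle\eta,f_i\rangle^2$ on $T^*G$, the geodesic with initial covector $\eta\in T^*_{p_0}G$ is $\gamma_\eta(t)=\pi(e^{t\vec H}(\eta))$, where $\vec H$ is the Hamiltonian vector field of $H$ and $\pi:T^*G\to G$ the projection; the exponential map is $\hat E(\eta)=\gamma_\eta(1)$, and for $p\ne p_0$ one sets $\Gamma(p)=\hat E^{-1}(p)\subset T^*_{p_0}G$ with the subspace topology. Write $\eta=(u,\lambda)=(u_1,\dots,u_k,\lambda)$, with $u$ the components $\langle\eta,f_i\rangle$ ($u_j$ the projection on the invariant subspace of $\alpha_j$) and $\lambda=\langle\eta,f_0\rangle$. The decomposition is: with $I_0=\{j\mid x_j=0\}$, $\Gamma_0(p)=\{(u,\lambda)\in\Gamma(p)\mid\sum_{j\in I_0}\|u_j\|^2=0\}$ and $\Gamma_\infty(p)=\Gamma(p)\setminus\Gamma_0(p)$. ''Submanifold'' allows components of different dimensions. *)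

(* Defs.v *)
From HB Require Import structures.
From mathcomp Require Import all_boot all_order all_algebra.
From mathcomp Require Import all_classical all_reals all_analysis.
From mathcomp Require Import ring.
Set Implicit Arguments.
Unset Strict Implicit.
Unset Printing Implicit Defensive.
Import Order.TTheory GRing.Theory Num.Theory.
Import numFieldNormedType.Exports.
Local Open Scope classical_set_scope.
Local Open Scope ring_scope.

(* The contact Carnot group with structure matrix A, in exponential
   coordinates: (x, z) stands for exp (\sum_i x_i f_i + z f_0), and by the
   Baker-Campbell-Hausdorff formula the group law is
     (x, z) (y, w) = (x + y, z + w + 1/2 \sum_(i, j) x_i A_ij y_j),
   with identity (0, 0).  The same coordinates are used on all (co)tangent
   spaces. *)
Notation coords R m := ('rV[R]_m * R^o)%type (only parsing).

Section ContactCarnot.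
Variables (R : realType) (m : nat).
Implicit Types (A : 'M[R]_m) (p q w eta : coords R m).

Definition carnot_mul A p q : coords R m :=
  (p.1 + q.1, p.2 + q.2 + 2^-1 * (p.1 *m A *m q.1^T) 0 0).

(* The left-invariant vector field with value w at the identity. *)
Definition left_field A w : coords R m -> coords R m :=
  fun q => 'D_w (carnot_mul A q) 0.

(* frame A is f_1, ..., f_m and frame0 A is f_0; at the identity they are the
   coordinate vectors, so a covector eta there has eta.1 0 i = <eta, f_i> and
   eta.2 = <eta, f_0>. *)
Definition frame A (i : 'I_m) := left_field A (delta_mx 0 i, 0).
Definition frame0 A := left_field A (0, 1).

Lemma derive_affine (V W : normedModType R) (f : V -> W) (a v : V) (d : W) :
  (forall h : R, f (h *: v + a) - f a = h *: d) -> 'D_v f a = d.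
Proof.
move=> fE; rewrite /derive; apply: cvg_lim => //.
apply: cvg_near_cst; near=> h.
rewrite /= [X in _ *: X]fE scalerA mulVf ?scale1r//.
by near: h; exact: nbhs_dnbhs_neq.
Unshelve. all: by end_near. Qed.

Lemma left_fieldE A w q : left_field A w q =
  (w.1, w.2 + 2^-1 * (q.1 *m A *m w.1^T) 0 0).
Proof.
apply: derive_affine => h; rewrite /carnot_mul /= !linear0 !addr0.
rewrite linearZ /= -scalemxAr mxE.
congr (_, _); first by rewrite /= addrAC subrr add0r.
by rewrite /= [X in _ - (_ + _ * X)]mxE /GRing.scale /=; ring.
Qed.

Lemma carnot_mulA A : associative (carnot_mul A).
Proof.
move=> p q r; congr (_, _); rewrite /= ?addrA//.
rewrite !mulmxDl linearD /= !mulmxDr !mxE; ring.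
Qed.

Lemma carnot_mul0l A : left_id 0 (carnot_mul A).
Proof. by move=> [x z]; rewrite /carnot_mul /= !mul0mx mxE mulr0 addr0 !add0r. Qed.

Lemma carnot_mulNl A : A^T = - A -> forall p, carnot_mul A (- p) p = 0.
Proof.
move=> skA p; have E : (p.1 *m A *m p.1^T) 0 0 = 0.
  have : (p.1 *m A *m p.1^T)^T = - (p.1 *m A *m p.1^T).
    by rewrite !trmx_mul trmxK skA mulNmx mulmxN mulmxA.
  move=> /matrixP/(_ 0 0); rewrite !mxE => /eqP.
  by rewrite -addr_eq0 -mulr2n mulrn_eq0 /= => /eqP.
by rewrite /carnot_mul /= !mulNmx mxE E oppr0 mulr0 addr0 !addNr.
Qed.

Definition lie_bracket (X Y : coords R m -> coords R m) q : coords R m :=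
  'D_(X q) Y q - 'D_(Y q) X q.

Lemma lie_bracket_left_field A v w : A^T = - A ->
  lie_bracket (left_field A v) (left_field A w) =
  left_field A (0, (v.1 *m A *m w.1^T) 0 0).
Proof.
move=> skA; apply/funext => q.
have D (x y : coords R m) :
    'D_x (left_field A y) q = (0, 2^-1 * (x.1 *m A *m y.1^T) 0 0).
  apply: derive_affine => h; rewrite !left_fieldE.
  congr (_, _); rewrite /= ?subrr ?scaler0//.
  rewrite !mulmxDl -!scalemxAl !mxE /GRing.scale /=; ring.
have E : (w.1 *m A *m v.1^T) 0 0 = - (v.1 *m A *m w.1^T) 0 0.
  have -> : w.1 *m A *m v.1^T = - (v.1 *m A *m w.1^T)^T.
    by rewrite !trmx_mul trmxK skA mulNmx mulmxN opprK mulmxA.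
  by rewrite !mxE.
rewrite /lie_bracket !D !left_fieldE /= E trmx0 mulmx0 [X in _ + _ * X]mxE.
by congr (_, _); rewrite /= ?subrr//; field.
Qed.

Lemma lie_bracket_frame A i j : A^T = - A ->
  lie_bracket (frame A i) (frame A j) = fun q => A i j *: frame0 A q.
Proof.
move=> skA; rewrite lie_bracket_left_field//; apply/funext => q.
rewrite /frame0 !left_fieldE /= trmx0 !mulmx0 -rowE trmx_delta -colE !mxE.
by congr (_, _); rewrite /= ?scaler0// /GRing.scale /=; ring.
Qed.

Lemma lie_bracket_frame0 A i : A^T = - A ->
  lie_bracket (frame A i) (frame0 A) = fun=> 0.
Proof.
move=> skA; rewrite lie_bracket_left_field//; apply/funext => q.
rewrite left_fieldE /= trmx0 !mulmx0 [X in X + _]mxE [X in _ + _ * X]mxE.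
by rewrite mulr0 addr0.
Qed.

Definition pairing eta w : R := \sum_i eta.1 0 i * w.1 0 i + eta.2 * w.2.

Definition hamiltonian A (s : coords R m * coords R m) : R^o :=
  2^-1 * \sum_i pairing s.2 (frame A i s.1) ^+ 2.

(* Canonical equations q' = dH/deta, eta' = - dH/dq on the cotangent bundle,
   whose points are written (q, eta). *)
Definition gradient (f : coords R m -> R^o) q : coords R m :=
  (\row_i 'D_(delta_mx 0 i, 0) f q, 'D_(0, 1) f q).

Definition hamiltonian_field A (s : coords R m * coords R m) :
    coords R m * coords R m :=
  (gradient (fun eta => hamiltonian A (s.1, eta)) s.2,
   - gradient (fun q => hamiltonian A (q, s.2)) s.1).

Definition integral_curve A (c : R -> coords R m * coords R m) : Prop :=
  forall t : R, is_derive t 1 c (hamiltonian_field A (c t)).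

(* The Hamiltonian field is complete, so exactly one curve satisfies the
   predicate and the default value is never used. *)
Definition extremal A eta : R -> coords R m * coords R m :=
  xget (fun=> (0, eta)) [set c | integral_curve A c /\ c 0 = (0, eta)].

Definition geodesic A eta : R -> coords R m := fun t => (extremal A eta t).1.

Definition exp_map A eta : coords R m := geodesic A eta 1.

Definition Gamma A p : set (coords R m) := exp_map A @^-1` [set p].

Definition sqnorm d (u : 'rV[R]_d) : R := \sum_i u 0 i ^+ 2.

(* By left_fieldE, frame A i = d/dx_i + (...) d/dz, so the components of a horizontal vector
   on the orthonormal frame are its x-coordinates. *)
Definition energy (g : R -> coords R m) : R :=
  2^-1 * \int[lebesgue_measure]_(t in `[0%R, 1%R]) sqnorm (derive1 g t).1.

Definition singular_value A (a : R) : Prop :=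
  0 <= a /\ eigenvalue (A^T *m A) (a ^+ 2).

(* Orthogonal projection of x on the A-invariant subspace attached to the
   singular value a. *)
Definition sv_proj A (a : R) (x : 'rV[R]_m) : 'rV[R]_m :=
  let V := eigenspace (A^T *m A) (a ^+ 2) in x *m proj_mx V (kermx V^T).

Definition Gamma0 A k (alpha : 'I_k -> R) p : set (coords R m) :=
  [set eta | Gamma A p eta /\
    \sum_(j < k | sv_proj A (alpha j) p.1 == 0)
      sqnorm (sv_proj A (alpha j) eta.1) = 0].

Definition Gammaoo A k (alpha : 'I_k -> R) p : set (coords R m) :=
  Gamma A p `\` Gamma0 A alpha p.

(* C^oo on the open set U: every iterated directional derivative is
   differentiable on U. *)
Definition iter_derive (vs : seq (coords R m)) (f : coords R m -> coords R m) :=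
  foldr (fun v g => 'D_v g) f vs.

Definition smooth_on (U : set (coords R m)) (f : coords R m -> coords R m) :=
  forall vs q, U q -> differentiable (iter_derive vs f) q.

(* Embedded submanifold, by slice charts; the dimension of the slice W may
   depend on the point. *)
Definition submanifold (S : set (coords R m)) : Prop :=
  forall q, S q ->
  exists (U V : set (coords R m)) (phi psi : coords R m -> coords R m)
         (W : {vspace coords R m}),
    [/\ [/\ open U, open V & U q],
        smooth_on U phi /\ smooth_on V psi,
        (forall x, U x -> V (phi x) /\ psi (phi x) = x),
        (forall y, V y -> U (psi y) /\ phi (psi y) = y) &
        phi @` (S `&` U) = V `&` [set y | y \in W]].

End ContactCarnot.

Definition homeomorphic (X Y : topologicalType) : Prop :=
  exists (f : X -> Y) (g : Y -> X),
    [/\ continuous f, continuous g, cancel f g & cancel g f].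

(* The unit sphere S^d of R^(d+1). *)
Definition sphere (R : realType) (d : nat) : set 'rV[R]_d.+1 :=
  [set v | sqnorm v = 1].
Arguments sphere : clear implicits.

Definition union_of_spheres (R : realType) (T : topologicalType) (S : set T) :=
  exists (I : choiceType) (d : I -> nat),
    homeomorphic (set_type S) {i : I & set_type (sphere R (d i))}.

(* Main.v *)
Require Import Defs.
From HB Require Import structures.
From mathcomp Require Import all_boot all_order all_algebra.
From mathcomp Require Import all_classical all_reals all_analysis.
From mathcomp Require Import ring lra complex.
Import Order.TTheory GRing.Theory Num.Theory.
Import numFieldNormedType.Exports.
Local Open Scope classical_set_scope.
Local Open Scope ring_scope.

(** Along an extremal the vertical covector l is constant and the momentum
    solves u' = l u A, so u, x and z are explicit trigonometric functions on
    each eigenspace V_j of A^T A, with J = A / alpha_j satisfying J^2 = -1 and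
    s = l alpha_j:
      x_j = (sin s / s + (1 - cos s) / s J) u_j,
      z = \sum_j alpha_j |u_j|^2 (s - sin s) / (2 s^2).
    For fixed l the first equation determines u_j unless s is a nonzero multiple
    of 2 pi; in that case it forces x_j = 0 and leaves u_j free, and the second
    equation prescribes the norm of the free part of u.  Hence the fibre of
    Gamma over l is empty, a point, or a round sphere of squared radius rho l,
    lying over a locally finite set of l; Gamma_0 and Gamma_oo are the parts
    with rho l = 0 and rho l > 0.  Points with rho l = 0 and l <> 0 solve
    z = \sum_j c_j g (l alpha_j) with c_j = alpha_j |x_j|^2 / 4 and
    g s = (s - sin s) / (1 - cos s), which is strictly convex between its poles
    and grows at least linearly, so there are finitely many of them. *)

(** * Spectral projectors of A^T A *)

(** The topological claims rest on one fact: [l] takes isolated values on the fibre, so nearby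
    points share a level. Closedness of the positive-radius part, continuity into the disjoint sum
    of spheres and constancy of the energy on components then reduce to a fixed [l]. Isolation needs
    two finiteness arguments: resonances are discrete by periodicity, while the zero-radius levels
    solve a transcendental equation, for which growth leaves finitely many pole-free intervals and
    convexity at most two solutions in each. At a resonance alpha_j (s - sin s) / (2 s^2) equals 1 /
    (2 l), the same weight for all free components; this is why their norms combine into a round
    sphere and not an ellipsoid. Smoothness asks that all iterated directional derivatives be
    differentiable, so the charts are taken in a class stable under differentiation: inversions are
    rational and are their own inverses. *)

Lemma symmetric_diagonalizable (R : rcfType) (n : nat) (S : 'M[R]_n) :
  S^T = S -> diagonalizable S.
Proof.
case: n S => [|n] S symS.
  by rewrite (flatmx0 S); exact: diagonalizable0.
(* Over the complex numbers S is unitarily conjugate to a real diagonal matrix, so both have the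
   same minimal polynomial. The equality descends to the reals because [map_poly f] is injective,
   and the minimal polynomial of a diagonal matrix splits with simple roots. *)
pose f := real_complex R; pose SC := map_mx f S.
have hermS : SC \is hermsymmx.
  apply/is_hermitianmxP; rewrite expr0 scale1r; apply/matrixP => i j.
  by rewrite !mxE -[in LHS]symS mxE; apply/eqP; rewrite eq_complex /= oppr0 !eqxx.
have /orthomx_spectralP SCE := hermitian_normalmx hermS.
have /mxOverP real_sp := hermitian_spectral_diag_real hermS.
pose d : 'rV[R]_n.+1 := \row_i complex.Re (spectral_diag SC 0 i).
have dE : spectral_diag SC = map_mx f d.
  apply/rowP => i; rewrite !mxE; have := real_sp 0 i.
  by case: (spectral_diag SC 0 i) => a b /complex_realP [c [-> ->]].
have minE : map_poly f (mxminpoly S) = map_poly f (mxminpoly (diag_mx d)).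
  have -> : map_poly f (mxminpoly S) = mxminpoly SC by rewrite mxminpoly_map.
  rewrite {1}SCE -conjVmx ?spectral_unit// mxminpoly_uconj ?unitmx_inv ?spectral_unit//.
  by rewrite dE -map_diag_mx mxminpoly_map.
apply/diagonalizableP; move/map_poly_inj: minE => ->.
by rewrite mxminpoly_diag; eexists; [|exact: dvdpp]; rewrite undup_uniq.
Qed.

Section Sqnorm.
Context {R : realType}.

Lemma sqnormE d (u : 'rV[R]_d) : sqnorm u = (u *m u^T) 0 0.
Proof. by rewrite mxE; apply: eq_bigr => i _; rewrite mxE expr2. Qed.

Lemma sqnorm_ge0 d (u : 'rV[R]_d) : 0 <= sqnorm u.
Proof. by apply: sumr_ge0 => i _; exact: sqr_ge0. Qed.

Lemma sqnorm_eq0 d (u : 'rV[R]_d) : (sqnorm u == 0) = (u == 0).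
Proof.
apply/eqP/eqP => [u0|->]; last by rewrite sqnormE mul0mx mxE.
apply/rowP => i; rewrite mxE; apply/eqP; rewrite -sqrf_eq0; apply/eqP.
move: u0 => /eqP; rewrite psumr_eq0; last by move=> j _; exact: sqr_ge0.
by move=> /allP/(_ i); rewrite mem_index_enum => /(_ isT)/eqP.
Qed.

Lemma sqnormZ d (a : R) (u : 'rV[R]_d) : sqnorm (a *: u) = a ^+ 2 * sqnorm u.
Proof.
by rewrite /sqnorm mulr_sumr; apply: eq_bigr => i _; rewrite mxE exprMn.
Qed.

End Sqnorm.

Section OrthogonalProjector.
Context {R : realType} {m : nat}.
Implicit Types (V A S : 'M[R]_m).

(** For row vectors [kermx V^T] is the orthogonal complement of the row space of V, so this
    projector is orthogonal; it is the matrix used in [sv_proj]. *)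
Definition ortho_projector V := proj_mx V (kermx V^T).

(** A row u = w V orthogonal to the rows of V satisfies |u|^2 = w (u V^T)^T = 0. *)
Lemma cap_ortho V : (V :&: kermx V^T)%MS = 0.
Proof.
apply/eqP; rewrite -submx0; apply/row_subP => i.
set u := row i _.
have: (u <= V :&: kermx V^T)%MS by exact: row_sub.
rewrite sub_capmx => /andP[/submxP[w uE] /sub_kermxP uV].
have: sqnorm u == 0.
  by rewrite sqnormE {1}uE -mulmxA -[V]trmxK -trmx_mul uV trmx0 mulmx0 mxE.
by rewrite sqnorm_eq0 => /eqP ->; exact: sub0mx.
Qed.

Lemma add_ortho V : row_full (V + kermx V^T)%MS.
Proof.
have dx : mxdirect (V + kermx V^T) by apply/mxdirect_addsP; exact: cap_ortho.
rewrite /row_full (mxdirectP dx) /= mxrank_ker mxrank_tr.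
by rewrite subnKC// rank_leq_row.
Qed.

Lemma ortho_projector_id V n (x : 'M[R]_(n, m)) :
  (x <= V)%MS -> x *m ortho_projector V = x.
Proof. by move=> xV; rewrite proj_mx_id// cap_ortho. Qed.

Lemma ortho_projector_0 V n (x : 'M[R]_(n, m)) :
  x *m V^T = 0 -> x *m ortho_projector V = 0.
Proof. by move=> xV; rewrite proj_mx_0 ?cap_ortho//; apply/sub_kermxP. Qed.

Lemma ortho_projector_sub V n (x : 'M[R]_(n, m)) :
  (x *m ortho_projector V <= V)%MS.
Proof. exact: proj_mx_sub. Qed.

Lemma ortho_projector_compl V n (x : 'M[R]_(n, m)) :
  (x - x *m ortho_projector V) *m V^T = 0.
Proof.
apply/sub_kermxP; apply: proj_mx_compl_sub.
by apply: submx_full; exact: add_ortho.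
Qed.

Lemma ortho_projector_idem V :
  ortho_projector V *m ortho_projector V = ortho_projector V.
Proof. by rewrite proj_mx_proj// cap_ortho. Qed.

(** The rows of 1 - P are orthogonal to V and P = w V, so (1 - P) P^T = 0; thus P^T = P P^T, which
    is symmetric. *)
Lemma ortho_projector_sym V : (ortho_projector V)^T = ortho_projector V.
Proof.
set P := ortho_projector V.
suff PPT : P = P *m P^T by rewrite PPT trmx_mul trmxK -PPT.
have [w PE] : exists w, P = w *m V.
  by apply/submxP; rewrite -[P]mul1mx; exact: ortho_projector_sub.
have := ortho_projector_compl V _ 1%:M; rewrite mul1mx -/P => cV.
suff : (1%:M - P) *m P^T = 0.
  rewrite mulmxBl mul1mx => /eqP; rewrite subr_eq0 => /eqP PT.
  by rewrite -{1}[P]trmxK {1}PT trmx_mul trmxK.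
by rewrite {2}PE trmx_mul mulmxA cV mul0mx.
Qed.

End OrthogonalProjector.

Section SingularProjectors.
Context {R : realType} {m : nat} (A : 'M[R]_m) (A_skew : A^T = - A).
Context (A_nondeg : A \in unitmx).
Context {k : nat} (alpha : 'I_k -> R).
Context (alpha_incr : forall i j : 'I_k, (i < j)%N -> alpha i < alpha j).
Context (alpha_sv : forall a : R, singular_value A a <-> exists j, alpha j = a).

Let S := A^T *m A.
Definition sv_projector (j : 'I_k) :=
  ortho_projector (eigenspace (A^T *m A) (alpha j ^+ 2)).
Local Notation P := sv_projector.

Lemma alpha_gt0 j : 0 < alpha j.
Proof.
have [a0 /eigenvalueP[v vS vn0]] : singular_value A (alpha j).
  by apply/alpha_sv; exists j.
rewrite lt_neqAle a0 andbT; apply/eqP => aj0.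
have US : S \in unitmx by rewrite unitmx_mul unitmx_tr A_nondeg.
case/eqP: vn0; apply: (can_inj (mulmxK US)).
by rewrite mul0mx vS -aj0 expr0n scale0r.
Qed.

Lemma alpha_inj : injective alpha.
Proof.
move=> i j aij; apply/val_inj; case: (ltngtP i j) => // /alpha_incr.
  by rewrite aij ltxx.
by rewrite aij ltxx.
Qed.

Lemma sv_projector_sym j : (P j)^T = P j.
Proof. exact: ortho_projector_sym. Qed.

Let symS : S^T = S.
Proof. by rewrite trmx_mul trmxK. Qed.

(** Eigenspaces of the symmetric S for distinct eigenvalues are orthogonal; the alpha_j^2 are
    distinct because the alpha_j are positive. *)
Lemma sv_projectorM i j : P i *m P j = if i == j then P i else 0.
Proof.
case: eqVneq => [->|ij]; first exact: ortho_projector_idem.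
apply: ortho_projector_0.
set Vi := eigenspace S (alpha i ^+ 2); set Vj := eigenspace _ _.
have ViVj : Vi *m Vj^T = 0.
  have Vis : Vi *m S = alpha i ^+ 2 *: Vi by apply/eigenspaceP; exact: submx_refl.
  have Vjs : Vj *m S = alpha j ^+ 2 *: Vj by apply/eigenspaceP; exact: submx_refl.
  have {}Vjs : S *m Vj^T = alpha j ^+ 2 *: Vj^T.
    by rewrite -[S in LHS]symS -trmx_mul Vjs linearZ.
  have : (alpha i ^+ 2 - alpha j ^+ 2) *: (Vi *m Vj^T) = 0.
    by rewrite scalerBl scalemxAl -Vis scalemxAr -Vjs -[X in X - _]mulmxA subrr.
  move=> /eqP; rewrite scaler_eq0 => /orP[|/eqP//].
  rewrite subr_eq0 eqrXn2 ?ltW ?alpha_gt0// => /eqP/alpha_inj ij'.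
  by rewrite ij' eqxx in ij.
have /submxP[w ->] : (P i <= Vi)%MS by rewrite -[P i]mul1mx; exact: ortho_projector_sub.
by rewrite -mulmxA ViVj mulmx0.
Qed.

(** Every eigenvalue r of S is some alpha_j^2: |v A^T|^2 = r |v|^2 makes r nonnegative and its
    square root a singular value. Diagonalizability then makes these eigenspaces span. *)
Lemma sum_sv_projector : \sum_j P j = 1%:M.
Proof.
have [rs _ rsE] :
    exists2 rs, uniq rs & (\sum_(r <- rs) eigenspace S r :=: 1%:M)%MS.
  by apply/diagonalizablePeigen; exact: symmetric_diagonalizable.
have full : (1%:M <= \sum_j eigenspace S (alpha j ^+ 2))%MS.
  rewrite -rsE; elim: rs {rsE} => [|r rs IH]; first by rewrite big_nil sub0mx.
  rewrite big_cons addsmx_sub IH andbT.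
  have [/eigenvalueP[v vS vn0]|] := boolP (eigenvalue S r); last first.
    by rewrite negbK => /eqP ->; exact: sub0mx.
  have r0 : 0 <= r.
    have E : sqnorm (v *m A^T) = r * sqnorm v.
      rewrite !sqnormE trmx_mul trmxK mulmxA -(mulmxA v) -/S vS.
      by rewrite -scalemxAl mxE.
    rewrite -(@pmulr_lge0 _ (sqnorm v)) -?E ?sqnorm_ge0//.
    by rewrite lt_neqAle sqnorm_ge0 eq_sym sqnorm_eq0 vn0.
  have [j aj] : exists j, alpha j = Num.sqrt r.
    apply/alpha_sv; split; first exact: sqrtr_ge0.
    by rewrite sqr_sqrtr//; apply/eigenvalueP; exists v.
  by rewrite (sumsmx_sup j)// aj sqr_sqrtr.
have /sub_sumsmxP[w wE] := full.
(* The identity is expanded as a sum of terms w_j V_j, each fixed by P_j and killed by the other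
   projectors. *)
rewrite -[LHS]mul1mx {2}wE -[LHS]mul1mx {1}wE mulmxA; rewrite mulmx1.
rewrite mulmx_suml; apply: eq_bigr => j _; rewrite mulmx_sumr (bigD1 j)//=.
rewrite [X in X + _]ortho_projector_id ?submxMl// big1 ?addr0// => i ij.
have PVj : w j *m eigenspace S (alpha j ^+ 2) *m P j = w j *m eigenspace S (alpha j ^+ 2).
  by rewrite [LHS]ortho_projector_id// submxMl.
by rewrite -PVj -mulmxA sv_projectorM eq_sym (negbTE ij) mulmx0.
Qed.

(** A commutes with S, so it preserves the eigenspace; being skew, it also preserves the orthogonal
    complement. In terms of P: P A P = P A and (1 - P) A P = 0. *)
Lemma sv_projectorC j : P j *m A = A *m P j.
Proof.
set V := eigenspace S (alpha j ^+ 2).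
have SA : S *m A = A *m S by rewrite /S A_skew !mulNmx mulmxN mulmxA.
have VA : (V *m A <= V)%MS.
  have Vs : V *m S = alpha j ^+ 2 *: V by apply/eigenspaceP; exact: submx_refl.
  by apply/eigenspaceP; rewrite -mulmxA -SA mulmxA Vs scalemxAl.
have [w PV] : exists w, P j = w *m V.
  by apply/submxP; rewrite -[P j]mul1mx; exact: ortho_projector_sub.
have PAP : P j *m A *m P j = P j *m A.
  apply: ortho_projector_id; rewrite PV -mulmxA; apply: submx_trans VA.
  exact: submxMl.
rewrite -PAP; apply/eqP; rewrite -subr_eq0 -[X in _ - X]mul1mx mulmxA -!mulmxBl.
rewrite -oppr_eq0 -!mulNmx opprB; apply/eqP/ortho_projector_0.
have [c VAc] : exists c, V *m A = c *m V by apply/submxP.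
have AV : A *m V^T = - (V^T *m c^T).
  by rewrite -(trmx_mul c V) -VAc (trmx_mul V A) A_skew mulNmx opprK.
by rewrite -mulmxA AV mulmxN mulmxA -[P j]mul1mx ortho_projector_compl mul0mx oppr0.
Qed.

Lemma sv_projector_sqr j : P j *m A *m A = - (alpha j ^+ 2) *: P j.
Proof.
have PS : P j *m S = alpha j ^+ 2 *: P j.
  by apply/eigenspaceP; rewrite -[P j]mul1mx; exact: ortho_projector_sub.
by rewrite scaleNr -PS /S A_skew mulNmx mulmxN opprK mulmxA.
Qed.

End SingularProjectors.

(** * Resonances and the convexity argument *)

Section PointwiseDerivatives.
Context {R : realType}.
Implicit Types (f g : R -> R) (x c : R).

(* An alias of the type class is_derive, hidden from instance resolution. *)
Definition has_der f x a := is_derive x 1 f a.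

Lemma has_der_cst c x : has_der (fun=> c) x 0.
Proof. exact: is_derive_cst. Qed.

Lemma has_der_id x : has_der (fun t : R => t) x 1.
Proof. exact: is_derive_id. Qed.

Lemma has_der_add f g x a b : has_der f x a -> has_der g x b ->
  has_der (fun t => f t + g t) x (a + b).
Proof. by move=> df dg; exact: (is_deriveD df dg). Qed.

Lemma has_der_opp f x a : has_der f x a -> has_der (fun t => - f t) x (- a).
Proof. by move=> df; exact: (is_deriveN df). Qed.

Lemma has_der_mul f g x a b : has_der f x a -> has_der g x b ->
  has_der (fun t => f t * g t) x (f x * b + g x * a).
Proof. by move=> df dg; exact: (is_deriveM df dg). Qed.

Lemma has_der_inv f x a : f x != 0 -> has_der f x a ->
  has_der (fun t => (f t)^-1) x (- f x ^- 2 * a).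
Proof. by move=> fx df; exact: (is_deriveV fx df). Qed.

Lemma has_der_comp f g x a b : has_der f (g x) a -> has_der g x b ->
  has_der (fun t => f (g t)) x (a * b).
Proof. by move=> df dg; exact: (is_derive1_comp df dg). Qed.

Lemma has_der_sin f x a : has_der f x a ->
  has_der (fun t => sin (f t)) x (cos (f x) * a).
Proof. by apply: has_der_comp; exact: is_derive_sin. Qed.

Lemma has_der_cos f x a : has_der f x a ->
  has_der (fun t => cos (f t)) x (- sin (f x) * a).
Proof. by apply: has_der_comp; exact: is_derive_cos. Qed.

Lemma has_der_sum n (h : 'I_n -> R -> R) x (a : 'I_n -> R) :
  (forall i, has_der (h i) x (a i)) ->
  has_der (fun t => \sum_i h i t) x (\sum_i a i).
Proof.
move=> dh; rewrite /has_der (_ : (fun t => _) = \sum_i h i).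
  exact: is_derive_sum.
by apply/funext => t; rewrite fct_sumE.
Qed.

Lemma has_der_eq f x a b : has_der f x a -> a = b -> has_der f x b.
Proof. by move=> ? <-. Qed.

End PointwiseDerivatives.

Ltac derive_rules := repeat first
  [ exact: has_der_id | exact: has_der_cst
  | apply: has_der_add | apply: has_der_opp | apply: has_der_mul | apply: has_der_inv
  | apply: has_der_sin | apply: has_der_cos ].

Section Trigonometry.
Context {R : realType}.
Implicit Types s t x : R.

Lemma one_sub_cos t : 1 - cos t = 2 * sin (t / 2) ^+ 2.
Proof.
rewrite {1}(splitr t) -mulr2n cos_mulr2n -mulr_natl.
by have := cos2Dsin2 (t / 2); lra.
Qed.

Lemma sin_cos_eq1 t : cos t = 1 -> sin t = 0.
Proof. by move=> ct; apply: cos1sin0; rewrite ct normr1. Qed.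

Lemma cos_neq1 t : 0 < t < pi *+ 2 -> cos t != 1.
Proof.
rewrite mulr2n => /andP[t0 t2]; apply/eqP => ct.
have s0 : 0 < sin (t / 2) by apply: sin_gt0_pi; apply/andP; split; lra.
by have := one_sub_cos t; rewrite ct subrr; have := exprn_gt0 2 s0; lra.
Qed.

Lemma cos_eq1_eq s t : cos s = 1 -> cos t = 1 -> `|t - s| < pi *+ 2 -> s = t.
Proof.
wlog st : s t / s <= t => [H|] cs ct.
  case: (leP s t) => [/H|/ltW/H {}H]; first exact.
  by rewrite distrC => ts; rewrite H.
rewrite ger0_norm ?subr_ge0// => ts; apply/eqP; rewrite eq_le st /= leNgt.
apply/negP => lt_st; have := @cos_neq1 (t - s).
rewrite subr_gt0 lt_st ts => /(_ isT); rewrite cosB cs ct (sin_cos_eq1 _ cs).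
by rewrite mulr0 addr0 mulr1 eqxx.
Qed.

(** The truncated quotient numbers the half-open period [2 pi n, 2 pi (n + 1)). The only multiple of
    2 pi in it is the left end, which cos s <> 1 keeps strictly below s. *)
Lemma cos_neq1_cell s t x : 0 < s -> s <= x <= t ->
  Num.truncn (s / (pi *+ 2)) = Num.truncn (t / (pi *+ 2)) ->
  cos s != 1 -> cos x != 1.
Proof.
have p0 : 0 < pi *+ 2 :> R by rewrite mulrn_wgt0// pi_gt0.
move=> s0 /andP[sx xt] st cs.
have t0 : 0 < t by apply: (lt_le_trans s0 (le_trans sx xt)).
have := @truncn_itv _ (s / (pi *+ 2)); have := @truncn_itv _ (t / (pi *+ 2)).
rewrite -st; set n := Num.truncn _.
rewrite !divr_ge0 ?(ltW s0, ltW t0, ltW p0)//.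
move=> /(_ isT) /andP[_ tn] /(_ isT) /andP[ns _].
move: ns tn; rewrite ler_pdivlMr// ltr_pdivrMr// mulr_natl mulr_natl.
rewrite [_ *+ n.+1]mulrS => ns tn.
have -> : cos x = cos (x - (pi *+ 2) *+ n).
  by rewrite -[in LHS](subrK ((pi *+ 2) *+ n) x) (periodicn (@cosD2pi R)).
apply: cos_neq1; apply/andP; split; last by lra.
rewrite subr_gt0 lt_neqAle (le_trans ns sx) andbT.
apply: contra cs => /eqP nx.
have -> : s = 0 + pi *+ 2 *+ n by apply/eqP; rewrite add0r eq_le ns nx sx.
by rewrite (periodicn (@cosD2pi R)) cos0.
Qed.

Lemma mean_value_pos (f df : R -> R) (a b : R) : a < b ->
  (forall x, a <= x <= b -> has_der f x (df x)) ->
  (forall x, a < x < b -> 0 < df x) -> f a < f b.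
Proof.
move=> ab drv pos.
have [x||c cab E] := @MVT _ f df _ _ ab.
- by rewrite in_itv /= => /andP[/ltW ax /ltW xb]; apply: drv; rewrite ax.
- apply: derivable_within_continuous => x; rewrite in_itv /= => /drv dx.
  by have [] := dx.
rewrite -subr_gt0 E mulr_gt0 ?subr_gt0//.
by apply: pos; move: cab; rewrite in_itv.
Qed.

(* Cusa's inequality: the derivative of s - 3 sin s / (2 + cos s) is
   ((1 - cos s) / (2 + cos s))^2. *)
Lemma cusa s : 0 < s -> 0 < 2 * s + s * cos s - 3 * sin s.
Proof.
(* Beyond 3 the bound s (2 + cos s) >= s > 3 >= 3 sin s is enough; up to 3 < 2 pi, cos differs from
   1 and the derivative of [f] is positive. *)
move=> s0; have [s3|s3] := ltP 3 s.
  have := sin_le1 s; have := cos_geN1 s => c1 s1.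
  have : 0 <= s * (cos s + 1) by rewrite mulr_ge0//; lra.
  by lra.
have c2 (x : R) : 0 < 2 + cos x by have := cos_geN1 x; lra.
pose f (x : R) := x - 3 * (sin x / (2 + cos x)).
pose df (x : R) := ((1 - cos x) / (2 + cos x)) ^+ 2.
have fdf (x : R) : has_der f x (df x).
  apply: has_der_eq; first by rewrite /f; derive_rules; rewrite gt_eqF.
  by rewrite /df; field: (sin2cos2 x); rewrite gt_eqF.
have : f 0 < f s.
  apply: (mean_value_pos f df 0 s s0) => [x _|x /andP[x0 xs]]; first exact: fdf.
  rewrite /df exprn_gt0// divr_gt0// subr_gt0 lt_neqAle cos_le1 andbT.
  by apply: cos_neq1; rewrite x0 mulr2n /=; have := pi_ge2 R; lra.
rewrite /f sin0 mul0r mulr0 subr0 subr_gt0 mulrA ltr_pdivrMr//.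
by rewrite mulrDr; lra.
Qed.

Lemma sin_lt s : 0 < s -> sin s < s.
Proof.
move=> s0; have := cusa s s0.
have : s * cos s <= s by rewrite ger_pMr// cos_le1.
by lra.
Qed.

(** Up to the factor 1/4 this is (s - sin s) / (2 s^2) divided by the modulus 2 (1 - cos s) / s^2.
    At its poles it is 0 by division by 0. *)
Definition slope s := (s - sin s) / (1 - cos s).
Definition slope1 s :=
  (2 - 2 * cos s - s * sin s) / ((1 - cos s) * (1 - cos s)).
Definition slope2 s := (2 * s + s * cos s - 3 * sin s) / (1 - cos s) ^+ 2.

Lemma slopeN s : slope (- s) = - slope s.
Proof. by rewrite /slope sinN cosN -opprD mulNr. Qed.

Lemma has_der_slope s : cos s != 1 -> has_der slope s (slope1 s).
Proof.
move=> cs; have cs' : 1 - cos s != 0 by rewrite subr_eq0 eq_sym.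
apply: has_der_eq; first by rewrite /slope; derive_rules.
by rewrite /slope1; field: (sin2cos2 s).
Qed.

Lemma has_der_slope1 s : cos s != 1 -> has_der slope1 s (slope2 s).
Proof.
move=> cs; have cs' : 1 - cos s != 0 by rewrite subr_eq0 eq_sym.
apply: has_der_eq.
  by rewrite /slope1; derive_rules; rewrite mulf_neq0.
by rewrite /slope2; field: (sin2cos2 s).
Qed.

Lemma slope2_gt0 s : 0 < s -> cos s != 1 -> 0 < slope2 s.
Proof.
move=> s0 cs; rewrite divr_gt0 ?cusa// exprn_gt0// subr_gt0.
by rewrite lt_neqAle cs cos_le1.
Qed.

Lemma slope_ge0 s : 0 <= s -> 0 <= slope s.
Proof.
rewrite le_eqVlt => /predU1P[<-|s0].
  by rewrite /slope sin0 subrr mul0r.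
by rewrite divr_ge0 ?subr_ge0 ?cos_le1// ltW// sin_lt.
Qed.

(** For s > 1, s - sin s >= s - 1 and 1 - cos s <= 2; for s <= 1 the left side is not positive. This
    linear growth bounds the solutions l. *)
Lemma slope_ge s : 0 < s -> cos s != 1 -> (s - 1) / 2 <= slope s.
Proof.
move=> s0 cs; have c1 : 0 < 1 - cos s by rewrite subr_gt0 lt_neqAle cs cos_le1.
rewrite ler_pdivlMr//.
have := sin_le1 s; have := cos_geN1 s; have := sin_lt s s0 => ss c s1.
have [s11|s11] := leP s 1.
  have : (s - 1) / 2 * (1 - cos s) <= 0 by rewrite mulr_le0_ge0//; lra.
  by lra.
have : (s - 1) * (1 - cos s) <= (s - 1) * 2 by rewrite ler_pM2l//; lra.
by lra.
Qed.

End Trigonometry.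

Lemma finite_set_le2 (R : realType) (S : set R) :
  (forall a b c, S a -> S b -> S c -> a < b -> b < c -> False) -> finite_set S.
Proof.
move=> S3; have [->|/set0P[a Sa]] := eqVneq S set0; first exact: finite_set0.
have [[b [Sb ab]]|nb] := pselect (exists b, S b /\ b <> a); last first.
  apply: (sub_finite_set _ (finite_set1 a)) => c Sc.
  by apply: contrapT => ca; apply: nb; exists c.
apply: (sub_finite_set _ (finite_set2 a b)) => c Sc /=.
have [->|ca] := eqVneq c a; first by left.
have [->|cb] := eqVneq c b; first by right.
move/eqP: ab => ab; exfalso.
case: (ltgtP c a) ca => // ca _; case: (ltgtP c b) cb => // cb _;
  case: (ltgtP b a) ab => // ab _.
- exact: (S3 c b a).
- exact: (S3 c a b).
- exact: (S3 b c a).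
- by have := lt_trans (lt_trans ca ab) cb; rewrite ltxx.
- by have := lt_trans (lt_trans ca cb) ab; rewrite ltxx.
- exact: (S3 a c b).
- exact: (S3 b a c).
- exact: (S3 a b c).
Qed.

Section SlopeSum.
Context {R : realType} {k : nat} (alpha c : 'I_k -> R).
Context (alpha0 : forall j, 0 < alpha j).
Context (c_ge0 : forall j, 0 <= c j).

(** Only the poles of terms with nonzero weight are excluded: where x_j = 0, the level l may be
    resonant for alpha_j. *)
Definition admissible (l : R) := forall j, c j != 0 -> cos (l * alpha j) != 1.
Definition slope_sum (l : R) := \sum_j c j * slope (l * alpha j).

(** The vector of period indices of all l alpha_j; between admissible points of one cell no relevant
    pole is crossed. [inord] is faithful as long as the indices are at most N. *)
Let cell N (l : R) : {ffun 'I_k -> 'I_N.+1} :=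
  [ffun j => inord (Num.truncn (l * alpha j / (pi *+ 2)))].

(** Three equal values give, by Rolle, two zeros of the first derivative and so one of the second,
    which is a nonnegative combination of positive terms with some nonzero weight. *)
Lemma slope_sum_convex (l1 l2 l3 : R) : (exists j, c j != 0) ->
  0 < l1 -> l1 < l2 -> l2 < l3 ->
  (forall l, l1 <= l <= l3 -> admissible l) ->
  slope_sum l1 = slope_sum l2 -> slope_sum l2 = slope_sum l3 -> False.
Proof.
move=> [j0 cj0] l10 l12 l23 adm E12 E23.
pose F1 l := \sum_j c j * (slope1 (l * alpha j) * alpha j).
pose F2 l := \sum_j c j * (slope2 (l * alpha j) * alpha j ^+ 2).
have d0 l : l1 <= l <= l3 -> has_der slope_sum l (F1 l).
  move=> /adm al; apply: has_der_sum => j.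
  (* A term of weight 0 may have a pole here, so it is differentiated as the zero function. *)
  have [cj|cj] := eqVneq (c j) 0.
    by rewrite cj mul0r (_ : (fun t => _) = fun=> 0);
      [exact: has_der_cst | apply/funext => t; rewrite mul0r].
  apply: has_der_eq.
    apply: has_der_mul; first exact: has_der_cst.
    apply: (@has_der_comp _ slope (fun t => t * alpha j)); last by derive_rules.
    exact/has_der_slope/al.
  by rewrite /=; ring.
have d1 l : l1 <= l <= l3 -> has_der F1 l (F2 l).
  move=> /adm al; apply: has_der_sum => j.
  have [cj|cj] := eqVneq (c j) 0.
    by rewrite cj mul0r (_ : (fun t => _) = fun=> 0);
      [exact: has_der_cst | apply/funext => t; rewrite mul0r].
  apply: has_der_eq.
    apply: has_der_mul; first exact: has_der_cst.
    apply: has_der_mul; last exact: has_der_cst.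
    apply: (@has_der_comp _ slope1 (fun t => t * alpha j)); last by derive_rules.
    exact/has_der_slope1/al.
  by rewrite /=; ring.
have rolle f df (a b : R) : a < b -> l1 <= a -> b <= l3 -> f a = f b ->
    (forall l, l1 <= l <= l3 -> has_der f l (df l)) ->
    exists2 x, a < x < b & df x = 0.
  move=> ab la bl fab fd.
  have inI x : x \in `[a, b]%R -> l1 <= x <= l3.
    by rewrite in_itv /= => /andP[ax xb]; rewrite (le_trans la ax) (le_trans xb bl).
  have sub x : x \in `]a, b[%R -> x \in `[a, b]%R by exact: subset_itv_oo_cc.
  have [x /sub/inI/fd dx||x xab dx] := Rolle ab _ _ fab.
  - by have [] := dx.
  - by apply: derivable_within_continuous => x /inI/fd[].
  exists x; first by move: xab; rewrite in_itv.
  have /sub/inI/fd/@derive_val <- := xab.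
  exact: derive_val.
have [x1 /andP[x11 x12] F10] := rolle _ _ _ _ l12 (lexx _) (ltW l23) E12 d0.
have [x2 /andP[x21 x22] F20] := rolle _ _ _ _ l23 (ltW l12) (lexx _) E23 d0.
have x1x2 : x1 < x2 by apply: lt_trans x21.
have [x /andP[xx1 xx2] Fx0] := rolle F1 F2 _ _ x1x2 (ltW x11) (ltW x22)
  (etrans F10 (esym F20)) d1.
have lx : l1 <= x <= l3 by rewrite !ltW// ?(lt_trans x11)// ?(lt_trans xx2).
have x0 : 0 < x by apply: lt_trans xx1; exact: lt_trans x11.
have pos j : c j != 0 -> 0 < slope2 (x * alpha j) * alpha j ^+ 2.
  by move=> cj; rewrite mulr_gt0 ?exprn_gt0// slope2_gt0 ?mulr_gt0//; exact: adm.
have : 0 < F2 x; last by rewrite Fx0 ltxx.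
rewrite /F2 (bigD1 j0)//= ltr_wpDr//.
  apply: sumr_ge0 => j _; have [->|cj] := eqVneq (c j) 0; first by rewrite mul0r.
  by rewrite mulr_ge0// ltW// pos.
by rewrite mulr_gt0 ?pos// lt_neqAle eq_sym cj0 c_ge0.
Qed.

(** The growth of one term with positive weight bounds l, hence the number of cells; in each cell
    convexity leaves at most two solutions. *)
Lemma finite_slope_sum_pos (z : R) : (exists j, c j != 0) ->
  finite_set [set l | [/\ 0 < l, admissible l & slope_sum l = z]].
Proof.
move=> nz; have [j0 cj0] := nz; set S := [set l | _].
have [M SM] : exists M, forall l, S l -> l <= M.
  (* The bound solves c_j0 (l alpha_j0 - 1) / 2 <= z for l; the other terms of the sum are
     nonnegative. *)
  exists ((2 * (z / c j0) + 1) / alpha j0) => l [l0 al lz].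
  have cj0' : 0 < c j0 by rewrite lt_neqAle eq_sym cj0 c_ge0.
  rewrite ler_pdivlMr//.
  suff : (l * alpha j0 - 1) / 2 <= z / c j0 by lra.
  rewrite ler_pdivlMr// mulrC.
  apply: (@le_trans _ _ (c j0 * slope (l * alpha j0))).
    by rewrite ler_pM2l// slope_ge ?mulr_gt0// al.
  rewrite -lz /slope_sum (bigD1 j0)//= lerDl.
  by apply: sumr_ge0 => j _; rewrite mulr_ge0// slope_ge0// mulr_ge0// ltW.
have [N SN] : exists N, forall l j, S l -> (Num.truncn (l * alpha j / (pi *+ 2)) <= N)%N.
  pose B := (\sum_j Num.truncn (M * alpha j / (pi *+ 2)))%N.
  exists B => l j Sl; apply: (@leq_trans (Num.truncn (M * alpha j / (pi *+ 2)))).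
    apply: le_truncn; rewrite ler_pM2r; first by rewrite ler_pM2r//; exact: SM.
    by rewrite invr_gt0 mulrn_wgt0// pi_gt0.
  by rewrite /B (bigD1 j)//= leq_addr.
have -> : S = \bigcup_(e in [set: {ffun 'I_k -> 'I_N.+1}]) (S `&` [set l | cell N l = e]).
  apply/seteqP; split => [l Sl|l [e _ []]//].
  by exists (cell N l).
apply: bigcup_finite => [|e _]; first exact: finite_finset.
apply: finite_set_le2 => l1 l2 l3 [S1 e1] [S2 e2] [S3 e3] l12 l23.
have [l10 a1 z1] := S1; have [_ _ z2] := S2; have [_ _ z3] := S3.
apply: (slope_sum_convex _ _ _ nz l10 l12 l23); rewrite ?z1 ?z2 ?z3//.
move=> l /andP[l1l ll3] j cj.
apply: (@cos_neq1_cell _ (l1 * alpha j) (l3 * alpha j)).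
- by rewrite mulr_gt0.
- by rewrite !ler_pM2r// l1l.
- move: e3; rewrite -e1 => /ffunP/(_ j); rewrite !ffunE => /(congr1 val) /=.
  by rewrite !inordK ?ltnS ?SN// => ->.
- exact: a1.
Qed.

End SlopeSum.

(** [slope] is odd, so the negative solutions for z are the opposites of the positive solutions for
    - z. *)
Lemma finite_slope_sum (R : realType) (k : nat) (alpha c : 'I_k -> R) (z : R) :
  (forall j, 0 < alpha j) -> (forall j, 0 <= c j) -> (exists j, c j != 0) ->
  finite_set [set l | l != 0 /\ admissible alpha c l /\ slope_sum alpha c l = z].
Proof.
move=> alpha0 c0 nz.
have fp := finite_slope_sum_pos alpha c alpha0 c0 z nz.
have fn := finite_image -%R (finite_slope_sum_pos alpha c alpha0 c0 (- z) nz).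
set P := [set l | _] in fp; set N := [set - l | l in _] in fn.
have fPN : finite_set (P `|` N) by rewrite finite_setU.
apply: sub_finite_set fPN.
move=> l [l0 [al lz]]; case: (ltgtP l 0) l0 => // l0 _; [right|by left].
exists (- l); rewrite ?opprK//; split; first by rewrite oppr_gt0.
  by move=> j cj; rewrite mulNr cosN; exact: al.
rewrite -lz /slope_sum -sumrN; apply: eq_bigr => j _.
by rewrite mulNr slopeN mulrN.
Qed.

(** A half-open period contains one zero of 1 - cos, so each j and period index admit at most one l
    >= 0; negative l follow by parity of cos. *)
Lemma finite_resonances (R : realType) (k : nat) (alpha : 'I_k -> R) (M : R) :
  (forall j, 0 < alpha j) ->
  finite_set [set l | (exists j, cos (l * alpha j) = 1) /\ `|l| <= M].
Proof.
move=> alpha0.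
have p0 : 0 < pi *+ 2 :> R by rewrite mulrn_wgt0// pi_gt0.
have fin j : finite_set [set l : R | cos (l * alpha j) = 1 /\ 0 <= l <= M].
  set S := [set l | _]; pose t (l : R) := Num.truncn (l * alpha j / (pi *+ 2)).
  have -> : S = \bigcup_(n in `I_(t M).+1) (S `&` [set l | t l = n]).
    apply/seteqP; split => [l Sl|l [e _ []]//]; exists (t l) => //=.
    rewrite ltnS; apply: le_truncn; case: Sl => _ /andP[_ lM].
    by rewrite ler_pM2r ?invr_gt0// ler_pM2r.
  apply: bigcup_finite => [|n _]; first exact: finite_II.
  apply: finite_set_le2 => a b _ [[ca /andP[a0 _]] ta] [[cb /andP[b0 _]] tb] _ ab _.
  have /(mulIf (lt0r_neq0 (alpha0 j))) E : a * alpha j = b * alpha j.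
    apply: cos_eq1_eq => //.
    have := @truncn_itv _ (a * alpha j / (pi *+ 2)).
    have := @truncn_itv _ (b * alpha j / (pi *+ 2)).
    rewrite -[Num.truncn _]/(t b) -[Num.truncn _]/(t a) ta tb.
    rewrite !divr_ge0 ?mulr_ge0 ?(ltW (alpha0 _)) ?(ltW p0)//.
    move=> /(_ isT) /andP[_ +] /(_ isT) /andP[+ _].
    rewrite ler_pdivlMr// ltr_pdivrMr// -[n.+1]addn1 natrD mulrDl mul1r => u v.
    rewrite ger0_norm; first by lra.
    by rewrite subr_ge0 ler_pM2r// ltW.
  by rewrite E ltxx in ab.
have fin' := bigcup_finite (@finite_finset _ [set: 'I_k]) (fun j _ => fin j).
set P := \bigcup_j _ in fin'.
have fP : finite_set (P `|` (-%R @` P)).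
  by rewrite finite_setU; split=> //; exact: finite_image.
apply: sub_finite_set fP.
move=> l [[j cj] lM]; case: (leP 0 l) => l0; [left|right].
  by exists j => //; split=> //; rewrite l0 (le_trans (ler_norm l)).
exists (- l); rewrite ?opprK//; exists j => //; split; first by rewrite mulNr cosN.
by rewrite oppr_ge0 ltW// (le_trans (ler_norm _))// normrN.
Qed.

(** * The Hamiltonian flow *)

Lemma sqnormD (R : realType) (n : nat) (u v : 'rV[R]_n) :
  sqnorm (u + v) = sqnorm u + 2 * (u *m v^T) 0 0 + sqnorm v.
Proof.
rewrite /sqnorm [in RHS]mxE mulr_sumr -!big_split /=; apply: eq_bigr => i _.
by rewrite !mxE; ring.
Qed.

Lemma skew_form0 (R : realType) (m : nat) (A : 'M[R]_m) (v : 'rV[R]_m) :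
  A^T = - A -> v *m A *m v^T = 0.
Proof.
move=> skA; have : (v *m A *m v^T)^T = - (v *m A *m v^T).
  by rewrite !trmx_mul trmxK skA mulNmx mulmxN mulmxA.
move=> /matrixP/(_ 0 0); rewrite !mxE => /eqP.
rewrite -addr_eq0 -mulr2n mulrn_eq0 /= => /eqP E.
by apply/matrixP => i j; rewrite !ord1 [LHS]mxE E mxE.
Qed.

Section SpectralCombination.
Context {R : realType} {m k : nat} (A : 'M[R]_m) (A_skew : A^T = - A).
Context (alpha : 'I_k -> R) (P : 'I_k -> 'M[R]_m).
Context (P_sym : forall j, (P j)^T = P j).
Context (P_mul : forall i j, P i *m P j = if i == j then P i else 0).
Context (P_sum : \sum_j P j = 1%:M).
Context (P_comm : forall j, P j *m A = A *m P j).
Context (P_sqr : forall j, P j *m A *m A = - (alpha j ^+ 2) *: P j).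

(** On the eigenspace of alpha_j, A is alpha_j times a complex structure, so this is multiplication
    by the complex number a_j + i alpha_j b_j there. Positions and momenta of the flow keep this
    form. *)
Definition comb (u : 'rV[R]_m) (a b : 'I_k -> R) : 'rV[R]_m :=
  \sum_j (a j *: (u *m P j) + b j *: (u *m P j *m A)).

Lemma comb_mulP u a b i :
  comb u a b *m P i = a i *: (u *m P i) + b i *: (u *m P i *m A).
Proof.
rewrite /comb mulmx_suml (bigD1 i)//= big1 ?addr0 => [|j ji].
  rewrite mulmxDl -!scalemxAl -!mulmxA -!P_comm !mulmxA -(mulmxA u (P i)).
  by rewrite !P_mul !eqxx.
rewrite mulmxDl -!scalemxAl -!mulmxA -!P_comm !mulmxA -(mulmxA u (P j)).
by rewrite !P_mul (negbTE ji) !mulmx0 mul0mx !scaler0 addr0.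
Qed.

Lemma mulP_sqr (u : 'rV[R]_m) j :
  u *m P j *m A *m A = - (alpha j ^+ 2) *: (u *m P j).
Proof. by rewrite -!mulmxA (mulmxA (P j)) P_sqr -scalemxAr. Qed.

Lemma comb_mulA u a b :
  comb u a b *m A = comb u (fun j => - (alpha j ^+ 2 * b j)) a.
Proof.
rewrite mulmx_suml; apply: eq_bigr => j _.
by rewrite mulmxDl -!scalemxAl mulP_sqr scalerA addrC mulrN mulrC.
Qed.

Lemma sum_mulP (u : 'rV[R]_m) : \sum_j u *m P j = u.
Proof. by rewrite -mulmx_sumr P_sum mulmx1. Qed.

Lemma comb10 u : comb u (fun=> 1) (fun=> 0) = u.
Proof.
rewrite -[RHS]sum_mulP; apply: eq_bigr => j _.
by rewrite scale1r scale0r addr0.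
Qed.

Lemma mulP_eq (u v : 'rV[R]_m) : (forall j, u *m P j = v *m P j) -> u = v.
Proof. by move=> E; rewrite -[u]sum_mulP -[v]sum_mulP; apply: eq_bigr. Qed.

Lemma dot_sum_mulP (u v : 'rV[R]_m) :
  u *m v^T = \sum_j (u *m P j) *m (v *m P j)^T.
Proof.
rewrite -{1}[u]sum_mulP mulmx_suml; apply: eq_bigr => j _.
by rewrite [(v *m P j)^T]trmx_mul P_sym mulmxA -[u *m P j *m P j]mulmxA P_mul eqxx.
Qed.

Lemma sqnorm_sum_mulP (u : 'rV[R]_m) : sqnorm u = \sum_j sqnorm (u *m P j).
Proof.
rewrite sqnormE dot_sum_mulP summxE; apply: eq_bigr => j _.
by rewrite sqnormE.
Qed.

(** Each coefficient is the real part of a_j + i alpha_j b_j times the conjugate of c_j + i alpha_j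
    d_j; the cross terms vanish because A is skew. *)
Lemma comb_dot u a b c d : (comb u a b *m (comb u c d)^T) 0 0 =
  \sum_j (a j * c j + alpha j ^+ 2 * (b j * d j)) * sqnorm (u *m P j).
Proof.
rewrite dot_sum_mulP summxE; apply: eq_bigr => j _; rewrite !comb_mulP.
set v := u *m P j.
have vA : v *m A *m v^T = 0 by exact: skew_form0.
have vAT : v *m (v *m A)^T = 0 by rewrite trmx_mul A_skew mulNmx mulmxN mulmxA vA oppr0.
have vAA : v *m A *m (v *m A)^T = alpha j ^+ 2 *: (v *m v^T).
  by rewrite trmx_mul A_skew mulNmx mulmxN mulmxA mulP_sqr -scalemxAl scaleNr opprK.
rewrite linearD !linearZ /= mulmxDl !mulmxDr -!scalemxAl -!scalemxAr vA vAT vAA.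
by rewrite !scaler0 addr0 add0r !scalerA -scalerDl mxE -sqnormE mulrC; ring.
Qed.

End SpectralCombination.

Section VectorDerivatives.
Context {R : realType}.

(** Linearity is asked only on difference quotients, so that [fst] and [snd] satisfy it by
    [erefl]. *)
Lemma is_derive_additive (V W W' : normedModType R) (L : W -> W') (f : V -> W)
    (x v : V) (df : W) : continuous L ->
  (forall (a : R) (y z : W), L (a *: (y - z)) = a *: (L y - L z)) ->
  is_derive x v f df -> is_derive x v (fun y => L (f y)) (L df).
Proof.
move=> cL linL [/cvg_ex[l fl] <-].
have fl' : (fun h : R => h^-1 *: ((L (f (h *: v + x))) - L (f x))) @ 0^' --> L l.
  rewrite (_ : (fun h => _) = L \o (fun h : R => h^-1 *: (f (h *: v + x) - f x))).
    by apply: continuous_cvg; [exact: cL|exact: fl].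
  by apply/funext => h /=; rewrite linL.
have -> : 'D_v f x = l by apply: cvg_lim => //; exact: fl.
split; first by apply/cvg_ex; exists (L l); exact: fl'.
by apply: cvg_lim => //; exact: fl'.
Qed.

Lemma is_derive_pair (V W W' : normedModType R) (f : V -> W) (g : V -> W')
    (x v : V) (df : W) (dg : W') :
  is_derive x v f df -> is_derive x v g dg ->
  is_derive x v (fun y => (f y, g y)) (df, dg).
Proof.
move=> [/cvg_ex[l fl] <-] [/cvg_ex[l' gl] <-].
have -> : 'D_v f x = l by apply: cvg_lim => //; exact: fl.
have -> : 'D_v g x = l' by apply: cvg_lim => //; exact: gl.
have fg := cvg_pair fl gl.
split; first by apply/cvg_ex; exists (l, l'); exact: fg.
by apply: cvg_lim => //; exact: fg.
Qed.

Lemma is_derive_row (V : normedModType R) (n : nat) (f : V -> 'rV[R]_n)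
    (x v : V) (df : 'rV[R]_n) :
  (forall i, is_derive x v (fun y => f y 0 i) (df 0 i)) -> is_derive x v f df.
Proof.
move=> fi; have df' : derivable f x v.
  by apply/derivable_mxP => i j; rewrite ord1; have [] := fi j.
split=> //; rewrite derive_mx//; apply/rowP => i; rewrite mxE.
exact: derive_val.
Qed.

(** Since w is affine along v, the difference quotient is exactly e + h |d|^2 / 2. *)
Lemma derive_half_sqnorm (V : normedModType R) (n : nat) (w : V -> 'rV[R]_n)
    (a v : V) (d : 'rV[R]_n) : (forall h : R, w (h *: v + a) = w a + h *: d) ->
  'D_v (fun y => 2^-1 * sqnorm (w y) : R^o) a = (w a *m d^T) 0 0.
Proof.
move=> wE; apply: cvg_lim => //.
set e := (w a *m d^T) 0 0.
suff E : {near 0^', (fun h : R => e + h * (2^-1 * sqnorm d)) =1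
    (fun h : R => h^-1 *: (2^-1 * sqnorm (w (h *: v + a)) - 2^-1 * sqnorm (w a) : R^o))}.
  apply: (cvg_trans (near_eq_cvg E)).
  suff : (fun h : R => e + h * (2^-1 * sqnorm d)) @ 0^' -->
      e + 0 * (2^-1 * sqnorm d) by rewrite mul0r addr0.
  apply: cvgD; first exact: cvg_cst.
  apply: cvgM; last exact: cvg_cst.
  exact: cvg_within.
near=> h; have h0 : h != 0 by near: h; exact: nbhs_dnbhs_neq.
rewrite wE sqnormD sqnormZ linearZ /= -scalemxAr mxE -/e /GRing.scale /=.
by field.
Unshelve. all: by end_near. Qed.

End VectorDerivatives.

Lemma pair_congr (S T : Type) (a a' : S) (b b' : T) :
  a = a' -> b = b' -> (a, b) = (a', b').
Proof. by move=> -> ->. Qed.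

Section HamiltonianField.
Context {R : realType} {m : nat} (A : 'M[R]_m) (A_skew : A^T = - A).
Implicit Types (q eta : coords R m) (s : coords R m * coords R m).

(** The values <eta, f_i> at the moving point, as opposed to the coordinates of eta; they satisfy
    the closed equation u' = l u A. *)
Definition momentum s : 'rV[R]_m :=
  s.2.1 + (s.2.2 / 2) *: (s.1.1 *m A).

Lemma pairing_frame s i : pairing s.2 (frame A i s.1) = momentum s 0 i.
Proof.
rewrite /frame left_fieldE /pairing /= add0r trmx_delta -colE.
rewrite (bigD1 i)//= big1 ?addr0 => [|j ji]; last first.
  by rewrite mxE (negbTE ji) andbF mulr0.
by rewrite /momentum !mxE !eqxx mulr1 mulrA.
Qed.

Lemma hamiltonianE s : hamiltonian A s = 2^-1 * sqnorm (momentum s).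
Proof. by congr (_ * _); apply: eq_bigr => i _; rewrite pairing_frame. Qed.

Lemma gradient_half_sqnorm (f : coords R m -> R^o) (w : coords R m -> 'rV[R]_m)
    (a : coords R m) (d : 'I_m -> 'rV[R]_m) (d0 : 'rV[R]_m) :
  (forall q, f q = 2^-1 * sqnorm (w q)) ->
  (forall i (h : R), w (h *: (delta_mx 0 i, 0) + a) = w a + h *: d i) ->
  (forall h : R, w (h *: (0, 1) + a) = w a + h *: d0) ->
  gradient f a = (\row_i (w a *m (d i)^T) 0 0, (w a *m d0^T) 0 0).
Proof.
move=> /funext -> di d0E; apply: pair_congr; last exact: derive_half_sqnorm.
by apply/rowP => i; rewrite mxE [RHS]mxE; exact: derive_half_sqnorm.
Qed.

Lemma hamiltonian_fieldE s : hamiltonian_field A s =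
  ((momentum s, 2^-1 * (s.1.1 *m A *m (momentum s)^T) 0 0),
   ((s.2.2 / 2) *: (momentum s *m A), 0)).
Proof.
case: s => [[x z] [xi l]]; apply: pair_congr => /=.
  rewrite (@gradient_half_sqnorm _ (fun eta => momentum ((x, z), eta)) _
    (fun i => delta_mx 0 i) (2^-1 *: (x *m A))).
  - apply: pair_congr.
      by apply/rowP => i; rewrite mxE trmx_delta -colE mxE.
    rewrite linearZ /= -scalemxAr mxE; congr (_ * _).
    by rewrite -[in LHS](trmxK (momentum _)) -trmx_mul mxE.
  - by move=> eta; rewrite hamiltonianE.
  - by move=> i h; rewrite /momentum /= scaler0 add0r -addrA addrC.
  - move=> h; rewrite /momentum /= scaler0 add0r [h *: 1]mulr1 mulrDl scalerDl.
    by rewrite addrA scalerA addrAC.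
rewrite (@gradient_half_sqnorm _ (fun q => momentum (q, (xi, l))) _
  (fun i => (l / 2) *: row i A) 0).
- rewrite -[LHS]/(- _, - _); apply: pair_congr; last first.
    by rewrite trmx0 mulmx0 mxE oppr0.
  apply/rowP => i; rewrite mxE [in LHS]mxE linearZ /= -scalemxAr mxE [in RHS]mxE.
  rewrite -mulrN; congr (_ * _).
  rewrite !mxE -sumrN; apply: eq_bigr => j _; rewrite -mulrN; congr (_ * _).
  by rewrite !mxE -[A in LHS]opprK -A_skew !mxE opprK.
- by move=> q; rewrite hamiltonianE.
- move=> i h; rewrite /momentum /= mulmxDl -scalemxAl -rowE scalerDr !scalerA.
  by rewrite addrA addrAC [h * _]mulrC.
- by move=> h; rewrite /momentum /= !scaler0 add0r addr0.
Qed.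

Lemma integral_curve_der c t : integral_curve A c ->
  [/\ forall i, has_der (fun t => (c t).1.1 0 i) t (momentum (c t) 0 i),
      has_der (fun t => (c t).1.2) t
        (2^-1 * ((c t).1.1 *m A *m (momentum (c t))^T) 0 0),
      forall i, has_der (fun t => (c t).2.1 0 i) t
        ((c t).2.2 / 2 * (momentum (c t) *m A) 0 i) &
      has_der (fun t => (c t).2.2) t 0].
Proof.
move=> /(_ t); rewrite hamiltonian_fieldE => dc.
have c1 (V W : normedModType R) : continuous (fst : V * W -> V).
  by move=> x; exact: cvg_fst.
have c2 (V W : normedModType R) : continuous (snd : V * W -> W).
  by move=> x; exact: cvg_snd.
have d1 := @is_derive_additive _ _ _ _ fst c t 1 _ (c1 _ _) (fun _ _ _ => erefl _) dc.
have d2 := @is_derive_additive _ _ _ _ snd c t 1 _ (c2 _ _) (fun _ _ _ => erefl _) dc.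
have d11 := @is_derive_additive _ _ _ _ fst _ t 1 _ (c1 _ _) (fun _ _ _ => erefl _) d1.
have d12 := @is_derive_additive _ _ _ _ snd _ t 1 _ (c2 _ _) (fun _ _ _ => erefl _) d1.
have d21 := @is_derive_additive _ _ _ _ fst _ t 1 _ (c1 _ _) (fun _ _ _ => erefl _) d2.
have d22 := @is_derive_additive _ _ _ _ snd _ t 1 _ (c2 _ _) (fun _ _ _ => erefl _) d2.
have linE i (a : R) (y z : 'rV[R]_m) : (a *: (y - z)) 0 i = a *: (y 0 i - z 0 i :> R^o).
  by rewrite !mxE.
have cE i : continuous (fun y : 'rV[R]_m => y 0 i : R^o) by exact: coord_continuous.
split=> // i.
  exact: (@is_derive_additive _ _ _ _ _ _ t 1 _ (cE i) (linE i) d11).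
have := @is_derive_additive _ _ _ _ _ _ t 1 _ (cE i) (linE i) d21.
by rewrite /= mxE.
Qed.

Lemma has_der0_cst (f : R -> R) x y : (forall t, has_der f t 0) -> f x = f y.
Proof. exact: is_derive_0_is_cst. Qed.

Lemma integral_curve_vertical c t : integral_curve A c -> (c t).2.2 = (c 0).2.2.
Proof.
move=> ic; apply: (has_der0_cst (fun t => (c t).2.2)) => r.
by have [] := integral_curve_der c r ic.
Qed.

(** The covector coordinates contribute (l / 2) u A and, since x' = u, the term (l / 2) x A
    contributes the other half. *)
Lemma has_der_momentum c t i : integral_curve A c ->
  has_der (fun t => momentum (c t) 0 i) t ((c 0).2.2 * (momentum (c t) *m A) 0 i).
Proof.
move=> ic; set l := (c 0).2.2.
have -> : (fun t => momentum (c t) 0 i) = (fun t => (c t).2.1 0 i +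
    l / 2 * \sum_j (c t).1.1 0 j * A j i).
  by apply/funext => r; rewrite !mxE integral_curve_vertical.
have [dx _ dxi _] := integral_curve_der c t ic.
apply: has_der_eq.
  apply: has_der_add; first exact: dxi.
  apply: has_der_mul; first exact: has_der_cst.
  by apply: has_der_sum => j; apply: has_der_mul; [exact: dx|exact: has_der_cst].
rewrite integral_curve_vertical// -/l mulr0 addr0.
under eq_bigr do rewrite mulr0 add0r mulrC.
by rewrite [in X in X + _]mxE [in RHS]mxE; field.
Qed.

(* The squared distance of the momenta is constant along two solutions because
   A is skew; this replaces a Gronwall argument. *)
Lemma integral_curve_unique c1 c2 : integral_curve A c1 -> integral_curve A c2 ->
  c1 0 = c2 0 -> c1 = c2.
Proof.
move=> ic1 ic2 c12.
have mu12 t : momentum (c1 t) = momentum (c2 t).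
  pose N t := \sum_i (momentum (c1 t) 0 i - momentum (c2 t) 0 i) *
    (momentum (c1 t) 0 i - momentum (c2 t) 0 i).
  have NE t' : N t' = sqnorm (momentum (c1 t') - momentum (c2 t')).
    by apply: eq_bigr => i _; rewrite !mxE expr2.
  have N0 : N t = N 0.
    apply: has_der0_cst => r; apply: has_der_eq.
      apply: has_der_sum => i.
      have D := has_der_add _ _ _ _ _ (has_der_momentum c1 r i ic1)
        (has_der_opp _ _ _ (has_der_momentum c2 r i ic2)).
      exact: (has_der_mul _ _ _ _ _ D D).
    rewrite /= -c12; set l := (c1 0).2.2; set w := momentum (c1 r) - momentum (c2 r).
    transitivity (2 * l * (w *m A *m w^T) 0 0); last first.
      by rewrite skew_form0// mxE mulr0.
    rewrite [in RHS]mxE mulr_sumr; apply: eq_bigr => i _.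
    by rewrite /w mulmxBl !mxE; ring.
  apply/eqP; rewrite -subr_eq0 -sqnorm_eq0 -NE N0 NE c12 subrr sqnorm_eq0.
  by [].
have x12 t : (c1 t).1.1 = (c2 t).1.1.
  apply/rowP => i; apply/eqP; rewrite -subr_eq0; apply/eqP.
  transitivity ((c1 0).1.1 0 i - (c2 0).1.1 0 i); last by rewrite c12 subrr.
  apply: (has_der0_cst (fun t => (c1 t).1.1 0 i - (c2 t).1.1 0 i)) => r.
  have [d1 _ _ _] := integral_curve_der c1 r ic1.
  have [d2 _ _ _] := integral_curve_der c2 r ic2.
  apply: has_der_eq; first by apply: has_der_add; [exact: d1|apply: has_der_opp; exact: d2].
  by rewrite mu12 subrr.
have z12 t : (c1 t).1.2 = (c2 t).1.2.
  apply/eqP; rewrite -subr_eq0; apply/eqP.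
  transitivity ((c1 0).1.2 - (c2 0).1.2); last by rewrite c12 subrr.
  apply: (has_der0_cst (fun t => (c1 t).1.2 - (c2 t).1.2)) => r.
  have [_ d1 _ _] := integral_curve_der c1 r ic1.
  have [_ d2 _ _] := integral_curve_der c2 r ic2.
  apply: has_der_eq; first by apply: has_der_add; [exact: d1|apply: has_der_opp; exact: d2].
  by rewrite mu12 x12 subrr.
apply/funext => t.
have l12 : (c1 t).2.2 = (c2 t).2.2.
  by rewrite (integral_curve_vertical c1)// (integral_curve_vertical c2)// c12.
have xi12 : (c1 t).2.1 = (c2 t).2.1.
  by have := mu12 t; rewrite /momentum l12 x12 => /addIr.
move: (x12 t) (z12 t) l12 xi12.
by case: (c1 t) => [[? ?] [? ?]]; case: (c2 t) => [[? ?] [? ?]] /= -> -> -> ->.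
Qed.

End HamiltonianField.

Section ExplicitFlow.
Context {R : realType} {m k : nat} (A : 'M[R]_m) (A_skew : A^T = - A).
Context (alpha : 'I_k -> R) (P : 'I_k -> 'M[R]_m).
Context (alpha_gt0 : forall j, 0 < alpha j).
Context (P_sym : forall j, (P j)^T = P j).
Context (P_mul : forall i j, P i *m P j = if i == j then P i else 0).
Context (P_sum : \sum_j P j = 1%:M).
Context (P_comm : forall j, P j *m A = A *m P j).
Context (P_sqr : forall j, P j *m A *m A = - (alpha j ^+ 2) *: P j).
Context (u : 'rV[R]_m) (l : R).
Local Notation comb := (comb A P).

Lemma has_der_comb (a b : 'I_k -> R -> R) (a' b' : 'I_k -> R) t i :
  (forall j, has_der (a j) t (a' j)) -> (forall j, has_der (b j) t (b' j)) ->
  has_der (fun t => comb u (fun j => a j t) (fun j => b j t) 0 i) t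
    (comb u a' b' 0 i).
Proof.
move=> da db.
have -> : (fun t => comb u (fun j => a j t) (fun j => b j t) 0 i) =
    (fun t => \sum_j (a j t * (u *m P j) 0 i + b j t * (u *m P j *m A) 0 i)).
  by apply/funext => r; rewrite summxE; apply: eq_bigr => j _; rewrite !mxE.
apply: has_der_eq.
  apply: has_der_sum => j; apply: has_der_add.
    by apply: has_der_mul; [exact: da | exact: has_der_cst].
  by apply: has_der_mul; [exact: db | exact: has_der_cst].
rewrite summxE; apply: eq_bigr => j _; rewrite [in RHS]mxE.
by rewrite !mulr0 !add0r; congr (_ + _); rewrite [RHS]mxE mulrC.
Qed.

(** On the eigenspace of alpha_j, exp (t l A) is [flow_cos] + [flow_sin] A, and its integral from 0
    to t is [flow_a] + [flow_b] A. *)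
Definition flow_cos j t := cos (l * alpha j * t).
Definition flow_sin j t := sin (l * alpha j * t) / alpha j.
(* At l = 0 the limit value t must be imposed; flow_b needs no such case,
   since it divides 0 by 0 there. *)
Definition flow_a j t :=
  if l == 0 then t else sin (l * alpha j * t) / (l * alpha j).
Definition flow_b j t := (1 - cos (l * alpha j * t)) / (l * alpha j ^+ 2).

Definition flow_u t := comb u (fun j => flow_cos j t) (fun j => flow_sin j t).
Definition flow_x t := comb u (fun j => flow_a j t) (fun j => flow_b j t).
Definition flow_z t := 2^-1 * \sum_j alpha j * sqnorm (u *m P j) *
  ((l * alpha j * t - sin (l * alpha j * t)) / (l * alpha j) ^+ 2).
(** The covector coordinates are recovered from the momentum by subtracting (l / 2) x A. *)
Definition flow t : coords R m * coords R m :=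
  ((flow_x t, flow_z t), (flow_u t - (l / 2) *: (flow_x t *m A), l)).

Lemma has_der_flow_cos j t :
  has_der (flow_cos j) t (- (alpha j ^+ 2 * (l * flow_sin j t))).
Proof.
apply: has_der_eq; first by rewrite /flow_cos; derive_rules.
by rewrite /flow_sin /=; field; rewrite gt_eqF.
Qed.

Lemma has_der_flow_sin j t : has_der (flow_sin j) t (l * flow_cos j t).
Proof.
apply: has_der_eq; first by rewrite /flow_sin; derive_rules.
by rewrite /flow_cos /=; field; rewrite gt_eqF.
Qed.

Lemma has_der_flow_a j t : has_der (flow_a j) t (flow_cos j t).
Proof.
rewrite /flow_a /flow_cos; have [->|l0] := eqVneq l 0.
  by rewrite !mul0r cos0; exact: has_der_id.
apply: has_der_eq; first by derive_rules.
by rewrite /=; field; rewrite l0 gt_eqF.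
Qed.

Lemma has_der_flow_b j t : has_der (flow_b j) t (flow_sin j t).
Proof.
rewrite /flow_b /flow_sin; have [->|l0] := eqVneq l 0.
  rewrite !mul0r sin0 mul0r invr0.
  rewrite (_ : (fun t => _) = fun=> 0); first exact: has_der_cst.
  by apply/funext => r; rewrite mulr0.
apply: has_der_eq; first by derive_rules.
by rewrite /=; field; rewrite l0 gt_eqF.
Qed.

Lemma momentum_flow t : momentum A (flow t) = flow_u t.
Proof. by rewrite /momentum /= subrK. Qed.

Lemma has_der_flow_z t :
  has_der flow_z t (2^-1 * (flow_x t *m A *m (flow_u t)^T) 0 0).
Proof.
rewrite (comb_mulA _ alpha)// (comb_dot _ _ alpha)//.
apply: has_der_eq.
  rewrite /flow_z; apply: has_der_mul; first exact: has_der_cst.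
  apply: has_der_sum => j; apply: has_der_mul; first exact: has_der_cst.
  by derive_rules.
rewrite [X in _ + X = _]mulr0 addr0; congr (_ * _); apply: eq_bigr => j _ /=.
rewrite /flow_a /flow_b /flow_cos /flow_sin; have [->|l0] := eqVneq l 0.
  by rewrite !mul0r sin0 cos0 expr0n /= invr0; ring.
by field: (sin2cos2 (l * alpha j * t)); rewrite l0 gt_eqF.
Qed.

Lemma flow_integral : integral_curve A flow.
Proof.
move=> t; rewrite hamiltonian_fieldE// momentum_flow.
apply: is_derive_pair; apply: is_derive_pair.
- apply: is_derive_row => i; apply: has_der_comb => j.
    exact: has_der_flow_a.
  exact: has_der_flow_b.
- exact: has_der_flow_z.
- apply: is_derive_row => i /=.
  have E : (fun r => (flow_u r - (l / 2) *: (flow_x r *m A)) 0 i) =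
    (fun r => flow_u r 0 i - (l / 2) *
      comb u (fun j => - (alpha j ^+ 2 * flow_b j r)) (fun j => flow_a j r) 0 i).
    by apply/funext => r; rewrite /flow_x (comb_mulA _ alpha)// !mxE.
  rewrite E; apply: has_der_eq.
    apply: has_der_add.
      by apply: has_der_comb => j; [exact: has_der_flow_cos|exact: has_der_flow_sin].
    apply: has_der_opp; apply: has_der_mul; first exact: has_der_cst.
    apply: has_der_comb => j; last exact: has_der_flow_a.
    by apply: has_der_opp; apply: has_der_mul; [exact: has_der_cst|exact: has_der_flow_b].
  rewrite mulr0 addr0.
  (* The momentum has derivative l u A and the correction (l / 2) u A; their difference is the
     required (l / 2) u A. *)
  rewrite {1}/flow_u (comb_mulA _ alpha)//.
  have -> : comb u (fun j => - (alpha j ^+ 2 * (l * flow_sin j t)))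
      (fun j => l * flow_cos j t) = l *: comb u
      (fun j => - (alpha j ^+ 2 * flow_sin j t)) (fun j => flow_cos j t).
    rewrite scaler_sumr; apply: eq_bigr => j _.
    by rewrite scalerDr !scalerA; congr (_ *: _ + _); ring.
  have -> : comb u (fun j => - (alpha j ^+ 2 * flow_sin j t + flow_b j t * 0))
      (fun j => flow_cos j t) = comb u
      (fun j => - (alpha j ^+ 2 * flow_sin j t)) (fun j => flow_cos j t).
    by apply: eq_bigr => j _; rewrite mulr0 addr0.
  by rewrite !mxE; field.
Qed.

Lemma flow0 : flow 0 = (0, (u, l)).
Proof.
have x0 : flow_x 0 = 0.
  apply: big1 => j _; rewrite /flow_a /flow_b mulr0 sin0 cos0 subrr !mul0r.
  by case: ifP => _; rewrite !scale0r addr0.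
have z0 : flow_z 0 = 0.
  rewrite /flow_z big1 ?mulr0// => j _.
  by rewrite mulr0 sin0 subrr mul0r mulr0.
have u0 : flow_u 0 = u.
  rewrite -[RHS](comb10 A P P_sum); apply: eq_bigr => j _.
  by rewrite /flow_cos /flow_sin mulr0 sin0 cos0 mul0r.
by rewrite /flow x0 z0 u0 mul0mx scaler0 subr0.
Qed.

Lemma extremalE : extremal A (u, l) = flow.
Proof.
have [|ic c0] := @xgetPex _ (fun=> (0, (u, l)))
  [set c | integral_curve A c /\ c 0 = (0, (u, l))].
  by exists flow; split; [exact: flow_integral | exact: flow0].
by apply: (integral_curve_unique A A_skew _ _ ic flow_integral); rewrite c0 flow0.
Qed.

Lemma exp_mapE : exp_map A (u, l) = (flow_x 1, flow_z 1).
Proof. by rewrite /exp_map /geodesic extremalE. Qed.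

Lemma sqnorm_flow_u t : sqnorm (flow_u t) = sqnorm u.
Proof.
rewrite sqnormE (comb_dot _ _ alpha)// (sqnorm_sum_mulP P)//.
apply: eq_bigr => j _; rewrite /flow_cos /flow_sin.
rewrite (_ : _ + _ = 1) ?mul1r//.
by field: (sin2cos2 (l * alpha j * t)); rewrite gt_eqF.
Qed.

Lemma energyE : energy (geodesic A (u, l)) = 2^-1 * sqnorm u.
Proof.
rewrite /energy; congr (_ * _).
under eq_Rintegral => t _.
  have -> : (derive1 (geodesic A (u, l)) t).1 = flow_u t.
    have c1 : continuous (fst : coords R m * coords R m -> coords R m).
      by move=> x; exact: cvg_fst.
    have dc := flow_integral t; rewrite hamiltonian_fieldE// momentum_flow in dc.
    have := @is_derive_additive _ _ _ _ fst flow t 1 _ c1 (fun _ _ _ => erefl _) dc.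
    rewrite derive1E /geodesic extremalE => d1.
    by rewrite derive_val.
  rewrite sqnorm_flow_u; over.
rewrite /= Rintegral_cst.
  transitivity (sqnorm u * fine 1); last by rewrite mulr1.
  congr (_ * fine _).
  have := @lebesgue_measure_itv R `[0, 1]; rewrite /= lte01 oppr0 adde0.
  exact.
exact: measurable_itv.
Qed.

End ExplicitFlow.

(** * Rational maps and inversions *)

Section RationalMaps.
Context {R : realType}.

(** Iterated derivatives are given by a rational formula on U only, so differentiability has to pass
    between functions that agree near the point. *)
Lemma near_eq_differentiable (V W : normedModType R) (f g : V -> W) (x : V) :
  (\near x, f x = g x) -> differentiable g x -> differentiable f x.
Proof.
move=> fg /diff_locallyP[cd gd].
have fgx : f x = g x by exact: (nbhs_singleton fg).
have fd : f \o shift x = cst (f x) + 'd g x +o_ (0 : V) id.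
  move/eqaddoP: gd => gd; apply/eqaddoP => e e0.
  have := gd e e0; apply: filter_app.
  have fg0 : \forall h \near (0 : V), f (h + x) = g (h + x).
    by move: fg; rewrite (near_shift 0 x) subr0.
  apply: filterS fg0 => h fgh.
  by rewrite !fctE /= fgh fgx.
have dfE := diff_unique cd fd.
by apply/diff_locallyP; rewrite dfE.
Qed.

Context {V W : normedModType R} (U : set V).

(** A syntactic class stable under directional derivatives on U, which turns smoothness into an
    induction. [rational_lin] covers functions, such as coordinates, whose derivative does not
    depend on the point. *)
Inductive rational_fun : (V -> R^o) -> Prop :=
| rational_cst c : rational_fun (fun=> c)
| rational_lin L d : (forall q, differentiable L q) ->
    (forall v q, 'D_v L q = d v) -> rational_fun L
| rational_add f g : rational_fun f -> rational_fun g -> rational_fun (fun q => f q + g q)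
| rational_mul f g : rational_fun f -> rational_fun g -> rational_fun (fun q => f q * g q)
| rational_inv f : rational_fun f -> (forall q, U q -> f q != 0) ->
    rational_fun (fun q => (f q)^-1).

Lemma rational_differentiable f q : rational_fun f -> U q -> differentiable f q.
Proof.
move=> rf Uq; elim: rf => {f} [c|L d dL _|f g _ df _ dg|f g _ df _ dg|f _ df f0].
- exact: differentiable_cst.
- exact: dL.
- exact: (differentiableD df dg).
- exact: (differentiableM df dg).
- exact: (differentiableV df (f0 q Uq)).
Qed.

Lemma rational_derive f v : rational_fun f ->
  exists2 g, rational_fun g & forall q, U q -> 'D_v f q = g q.
Proof.
move=> rf; elim: rf => {f} [c|L d dL dE|f g rf [f' rf' fE] rg [g' rg' gE]
    |f g rf [f' rf' fE] rg [g' rg' gE]|f rf [f' rf' fE] f0].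
- by exists (fun=> 0); [exact: rational_cst|move=> q _; rewrite derive_cst].
- by exists (fun=> d v); [exact: rational_cst|move=> q _; rewrite dE].
- exists (fun q => f' q + g' q); first exact: rational_add.
  move=> q Uq; rewrite -fE// -gE//.
  have df : derivable f q v.
    by apply: diff_derivable; exact: rational_differentiable.
  have dg : derivable g q v.
    by apply: diff_derivable; exact: rational_differentiable.
  exact: (deriveD df dg).
- exists (fun q => f q * g' q + g q * f' q).
    by apply: rational_add; exact: rational_mul.
  move=> q Uq; rewrite -fE// -gE//.
  have df : derivable f q v.
    by apply: diff_derivable; exact: rational_differentiable.
  have dg : derivable g q v.
    by apply: diff_derivable; exact: rational_differentiable.
  exact: (deriveM df dg).
- exists (fun q => (- 1 * ((f q)^-1 * (f q)^-1)) * f' q).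
    have ri := rational_inv f rf f0.
    by do ![exact: rational_cst || exact: ri || apply: rational_mul || assumption].
  move=> q Uq; rewrite -fE//.
  have df : derivable f q v.
    by apply: diff_derivable; exact: rational_differentiable.
  rewrite [LHS](deriveV (f0 q Uq) df) expr2 mulN1r invfM.
  by [].
Qed.

(** Scalar coefficients times constant vectors: derivatives fall on the coefficients alone. *)
Inductive rational_map : (V -> W) -> Prop :=
| rational_map_scale c w : rational_fun c -> rational_map (fun q => c q *: w)
| rational_map_add f g : rational_map f -> rational_map g ->
    rational_map (fun q => f q + g q).

Lemma rational_map_differentiable f q :
  rational_map f -> U q -> differentiable f q.
Proof.
move=> rf Uq; elim: rf => {f} [c w rc|f g _ df _ dg].
  exact/differentiableZl/rational_differentiable.
exact: (differentiableD df dg).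
Qed.

Lemma rational_map_derive f v : rational_map f ->
  exists2 g, rational_map g & forall q, U q -> 'D_v f q = g q.
Proof.
move=> rf; elim: rf => {f} [c w rc|f g rf [f' rf' fE] rg [g' rg' gE]].
  have [c' rc' cE] := rational_derive c v rc.
  exists (fun q => c' q *: w); first exact: rational_map_scale.
  move=> q Uq; rewrite -cE//.
  have dc : is_derive q v c ('D_v c q).
    by apply: derivableP; apply: diff_derivable; exact: rational_differentiable.
  apply: derive_val.
  apply: (@is_derive_additive R V R^o W (fun r => r *: w)) => //.
    exact: scalel_continuous.
  by move=> a y z; rewrite -scalerBl scalerA.
exists (fun q => f' q + g' q); first exact: rational_map_add.
move=> q Uq; rewrite -fE// -gE//.
have df : derivable f q v.
    by apply: diff_derivable; exact: rational_map_differentiable.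
have dg : derivable g q v.
    by apply: diff_derivable; exact: rational_map_differentiable.
exact: (deriveD df dg).
Qed.

Lemma rational_map_mul c f :
  rational_fun c -> rational_map f -> rational_map (fun q => c q *: f q).
Proof.
move=> rc; elim=> {f} [c' w rc'|f g _ rf _ rg].
  rewrite (_ : (fun q => _) = fun q => (c q * c' q) *: w).
    exact/rational_map_scale/rational_mul.
  by apply/funext => q; rewrite scalerA.
rewrite (_ : (fun q => _) = fun q => c q *: f q + c q *: g q).
  exact: rational_map_add.
by apply/funext => q; rewrite scalerDr.
Qed.

Lemma rational_map_cst w : rational_map (fun=> w).
Proof.
rewrite (_ : (fun=> w) = fun=> 1 *: w); last by rewrite scale1r.
exact/rational_map_scale/rational_cst.
Qed.

Lemma rational_sum n (f : 'I_n -> V -> R^o) :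
  (forall i, rational_fun (f i)) -> rational_fun (fun q => \sum_i f i q).
Proof.
move=> rf; rewrite (_ : (fun q => _) = \sum_i f i); last first.
  by apply/funext => q; rewrite fct_sumE.
elim/big_ind : _ => [|g h rg rh|i _]; first exact: rational_cst.
  exact: rational_add.
exact: rf.
Qed.

Lemma rational_map_sum n (f : 'I_n -> V -> W) :
  (forall i, rational_map (f i)) -> rational_map (fun q => \sum_i f i q).
Proof.
move=> rf; rewrite (_ : (fun q => _) = \sum_i f i); last first.
  by apply/funext => q; rewrite fct_sumE.
elim/big_ind : _ => [|g h rg rh|i _]; first exact: rational_map_cst.
  exact: rational_map_add.
exact: rf.
Qed.

Lemma rational_map_iter_derive f (vs : seq V) : open U -> rational_map f ->
  exists2 g, rational_map g &
    forall q, U q -> foldr (fun v h => 'D_v h) f vs q = g q.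
Proof.
move=> oU rf; elim: vs => [|v vs [g rg fg]]; first by exists f.
have [g' rg' gg'] := rational_map_derive g v rg.
exists g' => // q Uq; rewrite -gg'//.
apply: near_eq_derive; near=> y; apply: fg; near: y.
exact: open_nbhs_nbhs.
Unshelve. all: by end_near. Qed.

Lemma rational_map_iter_differentiable f (vs : seq V) q : open U ->
  rational_map f -> U q -> differentiable (foldr (fun v h => 'D_v h) f vs) q.
Proof.
move=> oU rf Uq; have [g rg fg] := rational_map_iter_derive f vs oU rf.
apply: near_eq_differentiable (rational_map_differentiable g q rg Uq).
near=> y; apply: fg; near: y; exact: open_nbhs_nbhs.
Unshelve. all: by end_near. Qed.

End RationalMaps.

Section SmoothCharts.
Context {R : realType} {m : nat}.
Local Notation V := (coords R m).

Lemma rational_map_smooth (U : set V) (f : V -> V) :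
  open U -> rational_map U f -> smooth_on U f.
Proof. by move=> oU rf vs q; exact: rational_map_iter_differentiable. Qed.

Lemma rational_coord (U : set V) i : rational_fun U (fun q : V => q.1 0 i).
Proof.
apply: (@rational_lin _ _ _ _ (fun v : V => v.1 0 i : R^o)) => [q|v q].
  apply: (@differentiable_comp _ _ _ _ (fst : V -> 'rV[R]_m) (fun x => x 0 i : R^o)).
    apply: (@linear_differentiable _ _ _ (fst : {linear V -> 'rV[R]_m})) => x.
    exact: cvg_fst.
  exact: differentiable_coord.
by apply: derive_affine => h; rewrite !mxE /= addrK.
Qed.

Lemma rational_vert (U : set V) : rational_fun U (fun q : V => q.2).
Proof.
apply: (@rational_lin _ _ _ _ (fun v : V => v.2)) => [q|v q].
  by apply: (@linear_differentiable _ _ _ (snd : {linear V -> R^o})) => x; exact: cvg_snd.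
by apply: derive_affine => h; rewrite /= addrK.
Qed.

Lemma coords_decomp (q : V) :
  q = \sum_i q.1 0 i *: ((delta_mx 0 i, 0) : V) + q.2 *: ((0, 1) : V).
Proof.
have E : \sum_i q.1 0 i *: ((delta_mx 0 i, 0) : V) = (q.1, 0).
  rewrite [q.1 in RHS]row_sum_delta.
  apply: (big_ind2 (fun (x : V) y => x = (y, 0))) => // [x y x' y' -> ->|i _].
    by rewrite -[LHS]/(y + y', 0 + 0 :> R^o) addr0.
  by rewrite -[LHS]/(q.1 0 i *: delta_mx 0 i, q.1 0 i *: 0 :> R^o) scaler0.
case: q E => x z /= ->.
by rewrite -[RHS]/(x + z *: 0, 0 + z * 1 :> R^o) scaler0 addr0 add0r mulr1.
Qed.

Lemma rational_map_id (U : set V) : rational_map U (fun q : V => q).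
Proof.
rewrite (_ : (fun q => q) = fun q : V =>
  \sum_i q.1 0 i *: ((delta_mx 0 i, 0) : V) + q.2 *: ((0, 1) : V)).
  apply: rational_map_add.
    by apply: rational_map_sum => i; apply: rational_map_scale; exact: rational_coord.
  by apply: rational_map_scale; exact: rational_vert.
by apply/funext => q; exact: coords_decomp.
Qed.

Lemma rational_map_shift (U : set V) (c : V) : rational_map U (fun q => q + c).
Proof. by apply: rational_map_add; [exact: rational_map_id|exact: rational_map_cst]. Qed.

(** The Euclidean square is polynomial, unlike the max norm carried by [coords R m]. *)
Definition sqnorm2 (q : V) : R := sqnorm q.1 + q.2 ^+ 2.

Lemma sqnorm2_eq0 q : (sqnorm2 q == 0) = (q == 0).
Proof.
rewrite paddr_eq0 ?sqnorm_ge0 ?sqr_ge0// sqnorm_eq0 sqrf_eq0.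
by case: q => x z /=; rewrite -pair_eqE.
Qed.

(** Inversion in the unit sphere; it fixes 0 because 1 / 0 = 0, so it is an involution of the whole
    space. *)
Definition inversion (q : V) : V := (sqnorm2 q)^-1 *: q.

Lemma sqnorm2Z (a : R) q : sqnorm2 (a *: q) = a ^+ 2 * sqnorm2 q.
Proof. by rewrite /sqnorm2 /= sqnormZ exprMn mulrDr. Qed.

Lemma inversionK q : inversion (inversion q) = q.
Proof.
have [->|q0] := eqVneq q 0; first by rewrite /inversion !scaler0.
rewrite /inversion sqnorm2Z scalerA.
rewrite (_ : _ * _ = 1) ?scale1r//.
by field; rewrite sqnorm2_eq0.
Qed.

Lemma inversion_eq0 q : (inversion q == 0) = (q == 0).
Proof. by rewrite scaler_eq0 invr_eq0 sqnorm2_eq0 orbb. Qed.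

Lemma open_punctured (c : V) : open (~` [set c]).
Proof.
exact/closed_openC/accessible_closed_set1/hausdorff_accessible/norm_hausdorff.
Qed.

Lemma rational_map_inversion (c d : V) :
  rational_map (~` [set c]) (fun q => inversion (q - c) + d).
Proof.
apply: rational_map_add; last exact: rational_map_cst.
apply: rational_map_mul; last exact: rational_map_shift.
apply: (@rational_inv _ _ _ (fun q => sqnorm2 (q - c))); last first.
  by move=> q /eqP qc; rewrite sqnorm2_eq0 subr_eq0.
have sq f : rational_fun (~` [set c]) f -> rational_fun (~` [set c]) (fun q => f q ^+ 2).
  by move=> rf; exact: (rational_mul _ _ _ rf rf).
apply: rational_add.
  apply: rational_sum => i; apply: sq.
  rewrite (_ : (fun q => _) = fun q : V => q.1 0 i - c.1 0 i).
    by apply: rational_add; [exact: rational_coord|exact: rational_cst].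
  by apply/funext => q; rewrite !mxE.
by apply: sq; apply: rational_add; [exact: rational_vert|exact: rational_cst].
Qed.

Lemma smooth_inversion (c d : V) :
  smooth_on (~` [set c]) (fun q => inversion (q - c) + d).
Proof.
apply: rational_map_smooth; first exact: open_punctured.
exact: rational_map_inversion.
Qed.

Lemma smooth_shift (U : set V) (c : V) : open U -> smooth_on U (fun q => q + c).
Proof. by move=> oU; apply: rational_map_smooth => //; exact: rational_map_shift. Qed.

Lemma smooth_on_subset (U U' : set V) (f : V -> V) :
  U `<=` U' -> smooth_on U' f -> smooth_on U f.
Proof. by move=> UU' sf vs q /UU'; exact: sf. Qed.

Lemma open_slab (l e : R) : open [set x : V | `|x.2 - l| < e].
Proof.
rewrite (_ : [set x : V | _] = (snd : V -> R^o) @^-1` (ball (l : R^o) e)).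
  by apply: open_comp; [move=> x _; exact: cvg_snd|exact: ball_open].
by apply/seteqP; split => x /=; rewrite /ball /= distrC.
Qed.

Lemma finite_closed (S : set V) : finite_set S -> closed S.
Proof.
have acc : accessible_space V by exact/hausdorff_accessible/norm_hausdorff.
by move=> fS; exact: (accessible_finite_set_closed.1 acc).
Qed.

(** Deleting the other points of S leaves a neighbourhood of q; after translation of q to 0 the
    slice is the zero subspace. *)
Lemma finite_submanifold (S : set V) : finite_set S -> submanifold S.
Proof.
move=> fS q Sq.
have oU : open (~` (S `\ q)).
  by apply: closed_openC; apply: finite_closed; exact: finite_setD.
have oV : open [set y | (~` (S `\ q)) (y + q)].
  apply: open_comp oU => y _.
  by apply: continuousD; [exact: cvg_id|exact: cvg_cst].
exists (~` (S `\ q)), [set y | (~` (S `\ q)) (y + q)],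
  (fun x => x + - q), (fun y => y + q), 0%VS; split.
- by split=> //; case=> _ /(_ erefl).
- by split; exact: smooth_shift.
- by move=> x Ux /=; rewrite !subrK.
- by move=> y Vy /=; rewrite addrK.
- apply/seteqP; split => [_ [x [Sx Ux] <-]|y [_] /=].
    have -> : x = q by apply: contrapT => xq; exact: Ux.
    by split; rewrite /= subrr ?mem0v// add0r; case=> _ /(_ erefl).
  rewrite memv0 => /eqP ->; exists q; last by rewrite subrr.
  by split=> //; case=> _ /(_ erefl).
Qed.

End SmoothCharts.

(** * Families of spheres over a locally finite set *)

Lemma locally_finite_isolated (R : realType) (L : set R) (l0 : R) :
  (forall M, finite_set (L `&` [set l | `|l| <= M])) ->
  exists2 e : R, 0 < e & forall l, `|l - l0| < e -> L l -> l = l0.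
Proof.
move=> finL; set F := (L `&` [set l | `|l| <= `|l0| + 1]) `\ l0.
have cF : closed F.
  have acc : accessible_space R^o by exact/hausdorff_accessible/norm_hausdorff.
  apply: (accessible_finite_set_closed.1 acc); exact/finite_setD/finL.
have : nbhs (l0 : R^o) (~` F).
  by apply: open_nbhs_nbhs; split; [exact: closed_openC|case=> _ /(_ erefl)].
rewrite -nbhs_ballE => -[e /= e0 ballF].
(* The cap 1 keeps |l| within |l0| + 1, the range in which [F] collects the points of L. *)
exists (Num.min e 1); first by rewrite lt_min e0 ltr01.
move=> l; rewrite lt_min => /andP[le l1] Ll; apply: contrapT => ll0.
apply: (ballF l); first by rewrite /ball /= distrC.
split=> //; split=> //=.
by rewrite -[l in `|l|](subrK l0) (le_trans (ler_normD _ _))// addrC lerD2l ltW.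
Qed.

(** Gram-Schmidt by deflation: a nonzero row of Q, normalized to e, is fixed by Q, and Q - e^T e is
    again a symmetric idempotent, of smaller rank. *)
Lemma orthonormal_basis (R : realType) (m : nat) (Q : 'M[R]_m) :
  Q^T = Q -> Q *m Q = Q ->
  exists r (B : 'M[R]_(r, m)), B *m B^T = 1%:M /\ B^T *m B = Q.
Proof.
move: {2}(\rank Q) (leqnn (\rank Q)) => n; elim: n Q => [|n IH] Q rQ sQ iQ.
  exists 0, 0; split; first by rewrite [LHS]flatmx0 [RHS]flatmx0.
  by move: rQ; rewrite leqn0 mxrank_eq0 => /eqP ->; rewrite mulmx0.
have [Q0|/row_subPn] := boolP (Q <= (0 : 'M[R]_m))%MS.
  exists 0, 0; split; first by rewrite [LHS]flatmx0 [RHS]flatmx0.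
  by move: Q0; rewrite submx0 => /eqP ->; rewrite mulmx0.
case=> i; rewrite submx0 => v0; set v := row i Q in v0.
have sv : 0 < sqnorm v by rewrite lt_neqAle sqnorm_ge0 eq_sym sqnorm_eq0 v0.
pose e := (Num.sqrt (sqnorm v))^-1 *: v.
have e1 : e *m e^T = 1%:M.
  apply/matrixP => x y; rewrite !ord1 -sqnormE sqnormZ exprVn sqr_sqrtr ?sqnorm_ge0//.
  by rewrite mulVf ?gt_eqF// mxE eqxx.
have eQ : e *m Q = e by rewrite /e -scalemxAl /v -row_mul iQ.
have Qe : Q *m e^T = e^T by rewrite -{1}sQ -trmx_mul eQ.
pose Q' := Q - e^T *m e.
have sQ' : Q'^T = Q' by rewrite linearB /= trmx_mul trmxK sQ.
have iQ' : Q' *m Q' = Q'.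
  rewrite /Q' mulmxBl !mulmxBr iQ mulmxA Qe -(mulmxA e^T e Q) eQ.
  by rewrite -(mulmxA e^T e) (mulmxA e) e1 mul1mx subrr subr0.
have eQ' : e *m Q' = 0 by rewrite /Q' mulmxBr eQ mulmxA e1 mul1mx subrr.
(* The rank drops because e lies in the row space of Q but, being nonzero and killed by the
   idempotent Q', not in that of Q'. *)
have rQ' : (\rank Q' <= n)%N.
  rewrite -ltnS (leq_trans _ rQ)//; apply: rank_ltmx.
  rewrite ltmxE; apply/andP; split.
    apply/submxP; exists Q'.
    by rewrite /Q' mulmxBl iQ -mulmxA eQ.
  apply/negP => QQ'; have /submxP[w ew] : (e <= Q')%MS.
    by apply: submx_trans QQ'; rewrite -eQ; exact: submxMl.
  have e0 : e = 0 by rewrite ew -iQ' mulmxA -ew eQ'.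
  by move: e1; rewrite e0 mul0mx => /matrixP/(_ 0 0)/eqP; rewrite !mxE eq_sym oner_eq0.
have [r [B [B1 BQ]]] := IH Q' rQ' sQ' iQ'.
have eB : e *m B^T = 0 by rewrite -[B^T]mulmx1 -B1 !mulmxA -(mulmxA e) BQ eQ' mul0mx.
exists (1 + r)%N, (col_mx e B); split.
  rewrite tr_col_mx mul_col_row e1 B1 eB.
  rewrite (_ : B *m e^T = 0); last by rewrite -[B]trmxK -trmx_mul eB trmx0.
  by rewrite -scalar_mx_block.
by rewrite tr_col_mx mul_row_col BQ /Q' addrC subrK.
Qed.

Section DotProduct.
Context {R : realType} {m : nat}.
Implicit Types u v w : 'rV[R]_m.

Lemma dotDl u v w :
  ((u + v) *m w^T) 0 0 = (u *m w^T) 0 0 + (v *m w^T) 0 0.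
Proof. by rewrite mulmxDl mxE. Qed.

Lemma dotZl (c : R) u w : ((c *: u) *m w^T) 0 0 = c * (u *m w^T) 0 0.
Proof. by rewrite -scalemxAl mxE. Qed.

Lemma dotZr (c : R) u w : (u *m (c *: w)^T) 0 0 = c * (u *m w^T) 0 0.
Proof. by rewrite linearZ /= -scalemxAr mxE. Qed.

Lemma dotNl u w : ((- u) *m w^T) 0 0 = - (u *m w^T) 0 0.
Proof. by rewrite mulNmx mxE. Qed.

Lemma dotNr u w : (u *m (- w)^T) 0 0 = - (u *m w^T) 0 0.
Proof. by rewrite linearN /= mulmxN mxE. Qed.

End DotProduct.

Section SliceMap.
Context {R : realType} {m : nat} (Q : 'M[R]_m) (w : 'rV[R]_m).

(** Its kernel is the direction space of the flattened sphere: for w fixed by the idempotent Q, y -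
    y Q and the multiple of w lie in complementary subspaces, hence vanish separately. *)
Definition slice_map (y : coords R m) : coords R m :=
  (y.1 - y.1 *m Q + (y.1 *m w^T) 0 0 *: w, y.2).

Lemma slice_map_linear : linear slice_map.
Proof.
move=> c x y; rewrite /slice_map /=; apply: pair_congr => //=.
rewrite dotDl dotZl !mulmxDl -!scalemxAl.
by apply/rowP => i; rewrite !mxE; ring.
Qed.

HB.instance Definition _ := GRing.isLinear.Build R (coords R m) (coords R m)
  *:%R slice_map slice_map_linear.

Definition slice_space : {vspace coords R m} := lker (linfun slice_map).

Lemma slice_spaceP y : w != 0 -> w *m Q = w -> Q *m Q = Q ->
  (y \in slice_space) <-> [/\ y.2 = 0, y.1 *m Q = y.1 & (y.1 *m w^T) 0 0 = 0].
Proof.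
move=> w0 wQ iQ; rewrite memv_ker lfunE /=; split; last first.
  by case=> y2 yQ yw; apply/eqP/pair_congr; rewrite // yQ yw subrr scale0r addr0.
move=> /eqP E0; have E := congr1 fst E0; have /= y2 := congr1 snd E0.
rewrite /= in E.
have dw : (y.1 *m w^T) 0 0 = 0.
  have := congr1 (mulmx^~ Q) E; rewrite mulmxDl mulmxBl -mulmxA iQ subrr add0r.
  rewrite -scalemxAl wQ mul0mx => /eqP; rewrite scaler_eq0 (negbTE w0) orbF.
  by move=> /eqP.
by split=> //; move: E; rewrite dw scale0r addr0 => /eqP; rewrite subr_eq0 => /eqP.
Qed.

End SliceMap.

Lemma continuous_mulmxr (R : realType) (n p : nat) (B : 'M[R]_(n, p)) :
  continuous (fun v : 'rV[R]_n => v *m B).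
Proof.
move=> v; rewrite (_ : (fun v => _) = \sum_i (fun v : 'rV[R]_n => v 0 i *: row i B)).
  elim/big_ind : _ => [|f g cf cg|i _]; first exact: cst_continuous.
    exact: continuousD.
  apply: (@continuous_comp _ _ _ (fun v : 'rV[R]_n => v 0 i : R^o) (fun r => r *: row i B)).
    exact: coord_continuous.
  exact: scalel_continuous.
by apply/funext => x; rewrite fct_sumE mulmx_sum_row.
Qed.

Lemma continuous_affine_mulmx (R : realType) (n p : nat) (c : 'rV[R]_p) (s : R)
    (B : 'M[R]_(n, p)) : continuous (fun v : 'rV[R]_n => c + s *: (v *m B)).
Proof.
have cs v : {for v, continuous (fun v : 'rV[R]_n => s *: (v *m B))}.
  apply: (@continuous_comp _ _ _ (fun v : 'rV[R]_n => v *m B) (fun w => s *: w)).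
    exact: continuous_mulmxr.
  exact: scaler_continuous.
have cc v : {for v, continuous (fun _ : 'rV[R]_n => c)} by exact: cst_continuous.
by move=> v; exact: (cvgD (cc v) (cs v)).
Qed.

Section SphereFamily.
Context {R : realType} {m : nat}.
Context (Q : R -> 'M[R]_m) (a : R -> 'rV[R]_m) (rho : R -> R) (Om : set R).
Context (Q_sym : forall l, (Q l)^T = Q l).
Context (Q_idem : forall l, Q l *m Q l = Q l).
Context (aQ : forall l, a l *m Q l = 0).
Context (zero_fin : finite_set [set l | Om l /\ rho l = 0]).
(** The levels that can carry a point: with Q l = 0, the equation |u Q l|^2 = rho l forces rho l =
    0. *)
Let Lam := [set l | Om l /\ (rho l = 0 \/ Q l != 0)].
Context (Lam_fin : forall M, finite_set (Lam `&` [set l | `|l| <= M])).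

Definition sphere_family : set (coords R m) := [set eta | [/\ Om eta.2,
  eta.1 - eta.1 *m Q eta.2 = a eta.2 & sqnorm (eta.1 *m Q eta.2) = rho eta.2]].
Definition sphere_family0 := [set eta | sphere_family eta /\ rho eta.2 = 0].
Definition sphere_familyoo := [set eta | sphere_family eta /\ rho eta.2 != 0].
Local Notation S0 := sphere_family0.
Local Notation Soo := sphere_familyoo.

Lemma sphere_family_Lam eta : sphere_family eta -> Lam eta.2.
Proof.
move=> [om _ rE]; split=> //; have [|r0] := eqVneq (rho eta.2) 0; first by left.
by right; apply: contra_neq r0 => q0; rewrite -rE q0 mulmx0; apply/eqP; rewrite sqnorm_eq0.
Qed.

Lemma finite_sphere_family0 : finite_set S0.
Proof.
apply: sub_finite_set (finite_image (fun l => (a l, l) : coords R m) zero_fin).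
move=> [u l] [[/= om ue re] r0]; exists l => //=.
move: re; rewrite r0 => /eqP; rewrite sqnorm_eq0 => /eqP uq.
by rewrite -ue uq subr0.
Qed.

(** By isolation, points of the family near a limit point have its level l0, so the limit is taken
    inside the fixed sphere over l0. *)
Lemma closed_sphere_familyoo : closed Soo.
Proof.
move=> eta clo; set l0 := eta.2.
have [e e0 iso] := locally_finite_isolated R Lam l0 Lam_fin.
have slab : nbhs eta [set x : coords R m | `|x.2 - l0| < e].
  by apply: open_nbhs_nbhs; split; [exact: open_slab|rewrite /= subrr normr0].
have near_slab B : nbhs eta B -> exists x, [/\ Soo x, B x & x.2 = l0].
  move=> nB; have [x [Sx [Bx xe]]] := clo _ (filterI nB slab).
  by exists x; split=> //; apply: iso xe _; apply: sphere_family_Lam; case: Sx.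
have [x0 [[[om0 _ _] r0] _ x02]] := near_slab _ filterT; rewrite x02 in om0 r0.
(* A sum of squares gathers both equations at level l0 into one polynomial, whose zero set is
   closed. *)
pose D (x : coords R m) : R^o := sqnorm (x.1 - x.1 *m Q l0 - a l0) +
  (sqnorm (x.1 *m Q l0) - rho l0) * (sqnorm (x.1 *m Q l0) - rho l0).
pose T := [set: coords R m].
have rc i : rational_fun T (fun x : coords R m => x.1 0 i).
  exact: rational_coord.
have rq i : rational_fun T (fun x : coords R m => (x.1 *m Q l0) 0 i).
  rewrite (_ : (fun x => _) = fun x : coords R m => \sum_j x.1 0 j * Q l0 j i).
    by apply: rational_sum => j; apply: rational_mul; [exact: rc|exact: rational_cst].
  by apply/funext => x; rewrite mxE.
have rD : rational_fun T D.
  have sq f : rational_fun T f -> rational_fun T (fun q => f q ^+ 2).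
    by move=> rf; exact: (rational_mul _ _ _ rf rf).
  have rs : rational_fun T (fun x : coords R m => sqnorm (x.1 *m Q l0) - rho l0).
    apply: rational_add; last exact: rational_cst.
    by apply: rational_sum => i; apply: sq; exact: rq.
  apply: rational_add; last exact: rational_mul.
  apply: rational_sum => i; apply: sq.
  rewrite (_ : (fun x => _) = fun x : coords R m =>
    x.1 0 i + - 1 * (x.1 *m Q l0) 0 i + - a l0 0 i).
    apply: rational_add; last exact: rational_cst.
    apply: rational_add; first exact: rc.
    by apply: rational_mul; [exact: rational_cst|exact: rq].
  by apply/funext => x; rewrite !mxE mulN1r.
have D0 (x : coords R m) : D x = 0 <->
    x.1 - x.1 *m Q l0 = a l0 /\ sqnorm (x.1 *m Q l0) = rho l0.
  rewrite /D -expr2; split.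
    move=> /eqP; rewrite paddr_eq0 ?sqnorm_ge0 ?sqr_ge0// sqnorm_eq0 sqrf_eq0.
    by rewrite !subr_eq0 => /andP[/eqP -> /eqP ->].
  by case=> -> ->; rewrite !subrr expr0n addr0; apply/eqP; rewrite sqnorm_eq0.
have cD : closed (D @^-1` [set 0]).
  apply: preimage_closed; last exact: closed_eq.
  move=> x _; apply: differentiable_continuous.
  exact: (rational_differentiable T).
have /D0[ua ur] : D eta = 0.
  apply: cD => B nB; have [x [[[om xa xr] _] Bx x2]] := near_slab B nB.
  by exists x; split=> //; apply/D0; rewrite -x2.
by split.
Qed.

Lemma open_within (T U : topologicalType) (f : T -> U) (D : set T) (O : set U) :
  open D -> (forall x, D x -> {for x, continuous f}) -> open O ->
  open (D `&` f @^-1` O).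
Proof.
move=> oD cf oO; rewrite openE => x [Dx Ox]; apply: filterI.
  exact: open_nbhs_nbhs.
by apply: (cf x Dx); exact: open_nbhs_nbhs.
Qed.

(* Inversion about the point N antipodal to q flattens the sphere through q:
   |x - c|^2 = |N - c|^2 becomes the affine condition 2 <y, c - N> = 1. *)
Lemma submanifold_sphere_familyoo : submanifold Soo.
Proof.
move=> [u0 l0] [[/= om0 ua0 ur0] r0].
have [e e0 iso] := locally_finite_isolated R Lam l0 Lam_fin.
set w0 := u0 *m Q l0 in ua0 ur0.
have w0Q : w0 *m Q l0 = w0 by rewrite /w0 -mulmxA Q_idem.
have w0n0 : w0 != 0 by rewrite -sqnorm_eq0 ur0.
(* The centre is u0 - w0, so the antipode of u0 is u0 - 2 w0. *)
pose N : coords R m := (u0 - 2 *: w0, l0).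
(* The inverse of the base point about N: 2 w0 / |2 w0|^2 with |w0|^2 = rho l0. Subtracting it makes
   the affine image a linear space. *)
pose y0 : coords R m := ((2 * rho l0)^-1 *: w0, 0).
pose phi x := inversion (x - N) + (- y0).
pose psi y := inversion (y - (- y0)) + N.
pose B : set (coords R m) := [set x | `|x.2 - l0| < e].
have oB : open B by exact: open_slab.
have phiK x : psi (phi x) = x.
  by rewrite /psi /phi addrK inversionK subrK.
have psiK y : phi (psi y) = y.
  by rewrite /psi /phi addrK inversionK subrK.
have phiN x : x <> N -> phi x <> - y0.
  move=> xN /eqP; rewrite -subr_eq0 addrK inversion_eq0 subr_eq0 => /eqP.
  exact: xN.
have psiN y : y <> - y0 -> psi y <> N.
  move=> yy /eqP; rewrite -subr_eq0 addrK inversion_eq0 subr_eq0 => /eqP.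
  exact: yy.
(* The slab [B] discards the spheres over other levels; its preimage under [psi] makes the two
   domains correspond. *)
exists (~` [set N] `&` B), (~` [set - y0] `&` psi @^-1` B), phi, psi,
  (slice_space (Q l0) w0); split.
- split; first by apply: openI => //; exact: open_punctured.
    apply: (open_within _ _ psi _ B (open_punctured (- y0)) _ oB).
    move=> y yy0; apply: differentiable_continuous.
    exact: (rational_map_differentiable _ _ _ (rational_map_inversion (- y0) N)).
  split; last by rewrite /B /= subrr normr0.
  move=> /(congr1 fst)/= /eqP; rewrite -subr_eq0 opprB addrC subrK scaler_eq0.
  by rewrite (negbTE w0n0) orbF pnatr_eq0.
- split; first by apply: smooth_on_subset (smooth_inversion N (- y0)); exact: subIsetl.
  by apply: smooth_on_subset (smooth_inversion (- y0) N); exact: subIsetl.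
- by move=> x [xN Bx]; rewrite phiK; split=> //; split; [exact: phiN|rewrite /= phiK].
- by move=> y [yy0 By]; rewrite psiK; split=> //; split; [exact: psiN|].
have ur0' : (w0 *m w0^T) 0 0 = rho l0 by rewrite -sqnormE.
apply/seteqP; split => [_ [[u l] [[[/= om ua ur] r] [uN /= ul]] <-]|].
  have ll0 : l = l0.
    by apply: iso ul _; apply: (sphere_family_Lam (u, l)).
  rewrite {l}ll0 in om ua ur r uN ul *.
  set x := (u, l0) : coords R m; pose v := u *m Q l0 + w0.
  have vQ : v *m Q l0 = v by rewrite mulmxDl w0Q -mulmxA Q_idem.
  have xN : x - N = (v, 0).
    rewrite -[LHS]/(u - (u0 - 2 *: w0), l0 - l0 :> R^o) subrr.
    apply: pair_congr => //; rewrite -[u in LHS](subrK (u *m Q l0)) ua -ua0 /v.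
    by apply/rowP => i; rewrite !mxE; ring.
  (* This is |v - w0|^2 = rho l0 expanded, the sphere seen from its point N. *)
  have dv : sqnorm v = 2 * (v *m w0^T) 0 0.
    rewrite sqnormD ur ur0 mulmxDl [in RHS]mxE ur0'; ring.
  have v0 : sqnorm v != 0.
    rewrite sqnorm_eq0; apply/eqP => v0; apply: uN; apply/eqP.
    by rewrite -subr_eq0 -/x xN v0.
  have phix : phi x = ((sqnorm v)^-1 *: v - (2 * rho l0)^-1 *: w0, 0).
    rewrite /phi /inversion xN /sqnorm2 /= expr0n addr0.
    by apply: pair_congr; rewrite //= oppr0 addr0 [LHS]mulr0.
  split; first by split; [exact: phiN|rewrite /= phiK].
  apply/slice_spaceP => //; rewrite phix; split=> //=.
    by rewrite mulmxBl -!scalemxAl vQ w0Q.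
  rewrite dotDl dotNl !dotZl ur0'.
  have -> : (v *m w0^T) 0 0 = sqnorm v / 2 by rewrite dv; field.
  by field; rewrite v0 r0.
move=> y [[yy0 By] /slice_spaceP[]//]; case: y yy0 By => y1 y2 yy0 By /= y20 y1Q y1w.
rewrite {y2}y20 in yy0 By *; set y := (y1, 0) : coords R m.
exists (psi y); last exact: psiK.
split; last by split; [exact: psiN|].
pose t := y1 + (2 * rho l0)^-1 *: w0; pose v := (sqnorm t)^-1 *: t.
have tQ : t *m Q l0 = t by rewrite mulmxDl -scalemxAl w0Q y1Q.
have tw : (t *m w0^T) 0 0 = 2^-1.
  by rewrite mulmxDl -scalemxAl mxE y1w mxE ur0' add0r; field.
have t0 : sqnorm t != 0.
  rewrite sqnorm_eq0; apply/eqP => t0; move: tw; rewrite t0 mul0mx mxE => /eqP.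
  by rewrite eq_sym invr_eq0 pnatr_eq0.
have psiy : psi y = (v + (u0 - 2 *: w0), l0).
  rewrite /psi /inversion opprK -[y + y0]/(t, 0 + 0 :> R^o) addr0 /sqnorm2 /=.
  rewrite expr0n addr0; apply: pair_congr; rewrite //= [X in X + _]mulr0 add0r.
  by [].
have xQ : (v + (u0 - 2 *: w0)) *m Q l0 = v - w0.
  rewrite !mulmxDl mulNmx -!scalemxAl tQ w0Q -/w0 /v.
  by apply/rowP => i; rewrite !mxE; ring.
rewrite psiy; split=> //; split=> //=; rewrite xQ.
  by rewrite -ua0; apply/rowP => i; rewrite !mxE; ring.
rewrite sqnormD dotNr dotZl tw -[- w0]scaleN1r !sqnormZ ur0.
by field.
Qed.

Let Idx : set R := [set l | [/\ Om l, 0 < rho l & Q l != 0]].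

Lemma sphere_familyoo_Idx eta : Soo eta -> Idx eta.2.
Proof.
move=> [Se r0]; have [om [r0'|Q0]] := sphere_family_Lam eta Se.
  by rewrite r0' eqxx in r0.
case: Se => _ _ rE; split=> //.
by rewrite lt_neqAle eq_sym r0 -rE sqnorm_ge0.
Qed.

(** A point goes to its level l and to the coordinates of u Q l in an orthonormal basis of the image
    of Q l, divided by the square root of rho l. Continuity into the disjoint sum holds because the
    level is locally constant. *)
Lemma union_of_spheres_sphere_familyoo : union_of_spheres R Soo.
Proof.
have basis (i : Idx) : exists d, exists B : 'M[R]_(d.+1, m),
    B *m B^T = 1%:M /\ B^T *m B = Q (set_val i).
  have [_ _ Q0] := set_mem (valP i).
  (* Q l <> 0 gives at least one basis vector, hence the dimension d + 1 required by [sphere]. *)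
  have [[|d] [B [B1 BQ]]] := orthonormal_basis R m (Q (set_val i)) (Q_sym _) (Q_idem _).
    by rewrite -[Q _]BQ [B]flatmx0 mulmx0 eqxx in Q0.
  by exists d, B.
have [d dP] := choice basis.
pose B i := sval (cid (dP i)).
have B1 i : B i *m (B i)^T = 1%:M by have [] := svalP (cid (dP i)).
have BQ i : (B i)^T *m B i = Q (set_val i) by have [] := svalP (cid (dP i)).
have r0 (i : Idx) : 0 < rho (set_val i) by have [] := set_mem (valP i).
have sr0 (i : Idx) : Num.sqrt (rho (set_val i)) != 0 by rewrite gt_eqF// sqrtr_gt0.
have aB (i : Idx) : a (set_val i) *m (B i)^T = 0.
  by rewrite -[(B i)^T]mulmx1 -B1 !mulmxA -(mulmxA (a _)) BQ aQ mul0mx.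
pose idx (eta : Soo) : Idx :=
  exist _ (set_val eta).2 (mem_set (sphere_familyoo_Idx _ (set_mem (valP eta)))).
pose vec (q : coords R m) (i : Idx) : 'rV[R]_(d i).+1 :=
  (Num.sqrt (rho (set_val i)))^-1 *: (q.1 *m (B i)^T).
have vecS q (i : Idx) : Soo q -> q.2 = set_val i -> sphere R (d i) (vec q i).
  move=> [[_ _ qr] _] q2; rewrite /sphere /= sqnormZ exprVn sqr_sqrtr ?ltW ?r0//.
  rewrite sqnormE trmx_mul trmxK mulmxA -(mulmxA q.1) BQ -q2.
  rewrite -Q_idem -{2}(Q_sym q.2) mulmxA -mulmxA -trmx_mul -sqnormE qr q2.
  by rewrite mulVf ?gt_eqF ?r0.
have e0P i : sphere R (d i) (delta_mx 0 0).
  by rewrite /sphere /= sqnormE trmx_delta mul_delta_mx mxE.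
(* A default point that makes [sph] total, so that it can be applied at a fixed index; it is not
   reached from points of level i. *)
pose e0 i : sphere R (d i) := exist _ (delta_mx 0 0) (mem_set (e0P i)).
pose sph i (v : 'rV[R]_(d i).+1) : sphere R (d i) := insubd (e0 i) v.
have sphE i v : sphere R (d i) v -> set_val (sph i v) = v.
  by move=> vS; apply: insubdK; exact: mem_set.
pose f (eta : Soo) : {i : Idx & sphere R (d i)} :=
  existT (fun i => sphere R (d i) : Type) (idx eta)
    (sph (idx eta) (vec (set_val eta) (idx eta))).
have fE (eta : Soo) (i : Idx) : (set_val eta).2 = set_val i ->
    f eta = existT (fun i => sphere R (d i) : Type) i (sph i (vec (set_val eta) i)).
  by move=> ei; have -> : i = idx eta by apply: val_inj; exact: esym ei.
pose g0 (i : Idx) (v : 'rV[R]_(d i).+1) : coords R m :=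
  (a (set_val i) + Num.sqrt (rho (set_val i)) *: (v *m B i), set_val i).
have g0Q (i : Idx) v : (g0 i v).1 *m Q (set_val i) = Num.sqrt (rho (set_val i)) *: (v *m B i).
  by rewrite /= mulmxDl aQ add0r -scalemxAl -mulmxA -[Q _]BQ (mulmxA (B i)) B1 mul1mx.
have g0S (i : Idx) v : sphere R (d i) v -> Soo (g0 i v).
  move=> vS; have [om _ _] := set_mem (valP i).
  split; last by rewrite /= gt_eqF ?r0.
  split=> //=; rewrite g0Q; first by rewrite addrK.
  rewrite sqnormZ sqr_sqrtr ?ltW ?r0// sqnormE trmx_mul mulmxA -(mulmxA v) B1 mulmx1.
  by rewrite -sqnormE vS mulr1.
pose g_ (i : Idx) (v : sphere R (d i)) : Soo :=
  exist _ (g0 i (set_val v)) (mem_set (g0S i _ (set_mem (valP v)))).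
have valC : continuous (set_val : Soo -> coords R m) by exact: initial_continuous.
have vecC i : continuous (fun q => vec q i).
  move=> q; apply: cvgZr.
  apply: (@continuous_comp _ _ _ (fst : coords R m -> 'rV[R]_m) (fun u => u *m (B i)^T)).
    exact: cvg_fst.
  exact: continuous_mulmxr.
pose g (x : {i : Idx & sphere R (d i)}) : Soo := g_ (projT1 x) (projT2 x).
exists Idx, d, f, g; split.
- move=> eta; set i := idx eta.
  have near_i : \forall x \near eta, (set_val x).2 = set_val i.
    have [e e_gt0 iso] := locally_finite_isolated R Lam (set_val i) Lam_fin.
    have nb : nbhs (set_val eta) [set x : coords R m | `|x.2 - set_val i| < e].
      by apply: open_nbhs_nbhs; split; [exact: open_slab|rewrite /= subrr normr0].
    have nb' : nbhs eta (set_val @^-1` [set x : coords R m | `|x.2 - set_val i| < e]).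
      exact: valC.
    apply: filterS nb' => x xe.
    apply: iso xe _; apply: sphere_family_Lam.
    by have [] := set_mem (valP x).
  (* Near eta, [f] is [h] followed by the inclusion of the single summand i, which removes the
     dependence of the type on the point. *)
  pose h (x : Soo) := sph i (vec (set_val x) i).
  have vc : {for eta, continuous (fun x : Soo => vec (set_val x) i)}.
    apply: (@continuous_comp _ _ _ (set_val : Soo -> coords R m) (fun q => vec q i)).
      exact: valC.
    exact: vecC.
  have ch : {for eta, continuous h}.
    move=> U; rewrite nbhsE => -[W [[Z oZ <-] Wh] WU].
    have vZ : Z (vec (set_val eta) i).
      by rewrite -[vec _ _]sphE//; apply: vecS => //; exact: set_mem (valP eta).
    have nZ : nbhs eta ((fun x : Soo => vec (set_val x) i) @^-1` Z).
      by apply: vc; exact: open_nbhs_nbhs.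
    apply: filterS (filterI nZ near_i) => x [Zx xi]; apply: WU.
    rewrite /= -[h x]/(sph i _) sphE//.
    by apply: vecS => //; exact: set_mem (valP x).
  have fh : {near eta, (existT (fun i => sphere R (d i) : Type) i \o h) =1 f}.
    by apply: filterS near_i => x xi; rewrite /= (fE x i xi).
  apply: (cvg_trans (near_eq_cvg fh)).
  exact: (cvg_comp _ _ ch
    (@existT_continuous _ (fun i => sphere R (d i) : topologicalType) i (h eta))).
- suff gC i : continuous (g_ i) by move=> [i v] U nU; exact: (gC i v U nU).
  apply: continuous_comp_initial => v.
  apply: (@continuous_comp _ _ _
    (set_val : sphere R (d i) -> 'rV[R]_(d i).+1) (g0 i)).
    exact: initial_continuous.
  have c1 : {for set_val v, continuous (fun w : 'rV[R]_(d i).+1 =>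
      a (set_val i) + Num.sqrt (rho (set_val i)) *: (w *m B i))}.
    exact: continuous_affine_mulmx.
  have c2 : {for set_val v, continuous (fun w : 'rV[R]_(d i).+1 => set_val i : R^o)}.
    exact: cst_continuous.
  exact: (cvg_pair c1 c2).
- move=> eta; apply: val_inj => /=.
  have Se := set_mem (valP eta); have [[_ ea _] _] := Se.
  rewrite sphE; last exact: vecS.
  rewrite /g0 /vec -scalemxAl scalerA mulfV// scale1r -mulmxA BQ /= -ea subrK.
  by rewrite [RHS]surjective_pairing.
- move=> [i v]; rewrite (fE _ i)//=; congr existT; apply: val_inj.
  rewrite -[LHS]/(set_val _) sphE; last first.
    by apply: vecS => //; exact: (g0S _ _ (set_mem (valP v))).
  rewrite /vec /g0 /= mulmxDl aB add0r -scalemxAl scalerA mulVf// scale1r.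
  by rewrite -mulmxA B1 mulmx1.
Qed.

(** The levels met by a connected set form an interval inside [Lam], whose points are isolated. *)
Lemma component_sphere_family eta eta' :
  connected_component sphere_family eta eta' -> eta.2 = eta'.2.
Proof.
move=> [C [Ceta CS Cconn] Ceta'].
pose E : set R := (snd : coords R m -> R^o) @` C.
have itvE : is_interval E.
  apply/connected_intervalP; apply: connected_continuous_connected => //.
  by apply: continuous_subspaceT => x; exact: cvg_snd.
have ELam l : E l -> Lam l by move=> [x /CS/sphere_family_Lam + <-].
(* A point slightly above l would lie in the interval, hence in [Lam], against isolation of l. *)
have lt_absurd l l' : E l -> E l' -> l < l' -> False.
  move=> El El' ll'.
  have [e e0 iso] := locally_finite_isolated R Lam l Lam_fin.
  pose y := l + Num.min e (l' - l) / 2.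
  have m0 : 0 < Num.min e (l' - l) by rewrite lt_min e0 subr_gt0.
  have me : Num.min e (l' - l) <= e by rewrite ge_min lexx.
  have ml : Num.min e (l' - l) <= l' - l by rewrite ge_min lexx orbT.
  have Ey : E y by apply: (itvE l l') => //; apply/andP; split; rewrite /y; lra.
  have : y = l.
    by apply: iso; [rewrite /y addrAC subrr add0r gtr0_norm; lra|exact: ELam].
  by rewrite /y; lra.
have Ee : E eta.2 by exists eta.
have Ee' : E eta'.2 by exists eta'.
by case: (ltgtP eta.2 eta'.2) => // h; exfalso; [exact: lt_absurd h|exact: lt_absurd h].
Qed.

End SphereFamily.

(** * Description of Gamma *)

Section GammaDescription.
Context {R : realType} {m k : nat} (A : 'M[R]_m) (A_skew : A^T = - A).
Context (alpha : 'I_k -> R) (P : 'I_k -> 'M[R]_m).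
Context (alpha_gt0 : forall j, 0 < alpha j).
Context (P_sym : forall j, (P j)^T = P j).
Context (P_mul : forall i j, P i *m P j = if i == j then P i else 0).
Context (P_sum : \sum_j P j = 1%:M).
Context (P_comm : forall j, P j *m A = A *m P j).
Context (P_sqr : forall j, P j *m A *m A = - (alpha j ^+ 2) *: P j).
Context (x : 'rV[R]_m) (z : R).

Let ca (l : R) (j : 'I_k) : R := flow_a alpha l j 1.
Let cb (l : R) (j : 'I_k) : R := flow_b alpha l j 1.

(* The squared modulus of the factor relating x_j to u_j; it vanishes exactly
   when l * alpha j is a nonzero multiple of 2 pi. *)
Definition modulus (l : R) (j : 'I_k) : R := ca l j ^+ 2 + alpha j ^+ 2 * cb l j ^+ 2.
Definition resonant_projector l := \sum_(j | modulus l j == 0) P j.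
Definition compatible : set R :=
  [set l | forall j, modulus l j = 0 -> x *m P j = 0].
(* Division by a zero modulus gives 0: resonant components do not contribute. *)
Definition fixed_part l :=
  comb A P x (fun j => ca l j / modulus l j) (fun j => - cb l j / modulus l j).
Definition area l j :=
  2^-1 * (alpha j * ((l * alpha j - sin (l * alpha j)) / (l * alpha j) ^+ 2)).
(** The factor 2 l inverts the common weight [area l j] of resonant components. At l = 0 nothing is
    resonant, the projector is 0, and squared radius z encodes the remaining equation z = 0. *)
Definition radius2 l := if l == 0 then z else
  2 * l * (z - \sum_j area l j * sqnorm (fixed_part l *m P j)).

Local Notation family :=
  (sphere_family resonant_projector fixed_part radius2 compatible).

Lemma modulusE l j : l != 0 ->
  modulus l j = 2 * (1 - cos (l * alpha j)) / (l * alpha j) ^+ 2.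
Proof.
move=> l0; rewrite /modulus /ca /cb /flow_a /flow_b (negbTE l0) !mulr1.
by field: (sin2cos2 (l * alpha j)); rewrite l0 gt_eqF.
Qed.

Lemma sqr_ca l j : ca l j ^+ 2 = modulus l j - alpha j ^+ 2 * cb l j ^+ 2.
Proof. by rewrite /modulus addrK. Qed.

Lemma modulus0 j : modulus 0 j = 1.
Proof.
by rewrite /modulus /ca /cb /flow_a /flow_b eqxx !mul0r cos0 subrr mul0r; ring.
Qed.

Lemma modulus_eq0 l j : modulus l j = 0 -> l != 0 /\ cos (l * alpha j) = 1.
Proof.
have [->|l0] := eqVneq l 0; first by rewrite modulus0 => /eqP; rewrite oner_eq0.
move=> m0; split=> //.
have E : 1 - cos (l * alpha j) = modulus l j * ((l * alpha j) ^+ 2 / 2).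
  by rewrite modulusE//; field; rewrite l0 gt_eqF.
by move: E; rewrite m0 mul0r; lra.
Qed.

Lemma cos_eq1_modulus l j : l != 0 -> cos (l * alpha j) = 1 -> modulus l j = 0.
Proof. by move=> l0 c1; rewrite modulusE// c1 subrr mulr0 mul0r. Qed.

Lemma resonant_coef l j : modulus l j = 0 -> ca l j = 0 /\ cb l j = 0.
Proof.
rewrite /modulus => /eqP; rewrite -exprMn paddr_eq0 ?sqr_ge0// !sqrf_eq0 mulf_eq0.
by rewrite (gt_eqF (alpha_gt0 j)) => /andP[/eqP -> /eqP ->].
Qed.

Lemma area_resonant l j : modulus l j = 0 -> 2 * l * area l j = 1.
Proof.
move=> /modulus_eq0[l0 /sin_cos_eq1 s0].
by rewrite /area s0; field; rewrite l0 gt_eqF.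
Qed.

Lemma resonant_projector_mulP l j :
  resonant_projector l *m P j = if modulus l j == 0 then P j else 0.
Proof.
rewrite mulmx_suml; case: ifPn => mj; last first.
  apply: big1 => i mi; rewrite P_mul; case: eqP => // ij.
  by rewrite -ij mi in mj.
rewrite (bigD1 j)//= P_mul eqxx big1 ?addr0// => i /andP[_ ij].
by rewrite P_mul (negbTE ij).
Qed.

Lemma resonant_projector_sym l : (resonant_projector l)^T = resonant_projector l.
Proof.
by rewrite /resonant_projector linear_sum; apply: eq_bigr => j _; exact: P_sym.
Qed.

Lemma resonant_projector_idem l :
  resonant_projector l *m resonant_projector l = resonant_projector l.
Proof.
rewrite {2}/resonant_projector mulmx_sumr; apply: eq_bigr => j mj.
by rewrite resonant_projector_mulP mj.
Qed.

Lemma sqnorm_resonant l (u : 'rV[R]_m) :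
  sqnorm (u *m resonant_projector l) = \sum_(j | modulus l j == 0) sqnorm (u *m P j).
Proof.
rewrite (sqnorm_sum_mulP P)// [RHS]big_mkcond; apply: eq_bigr => j _.
rewrite -mulmxA resonant_projector_mulP; case: ifP => // _.
by rewrite mulmx0; apply/eqP; rewrite sqnorm_eq0.
Qed.

Lemma fixed_part_mulP l j : fixed_part l *m P j =
  (modulus l j)^-1 *: (ca l j *: (x *m P j) - cb l j *: (x *m P j *m A)).
Proof.
rewrite comb_mulP// scalerBr !scalerA [X in X *: _]mulrC mulNr scaleNr.
by rewrite [cb l j / _]mulrC.
Qed.

Lemma fixed_part_resonant l : fixed_part l *m resonant_projector l = 0.
Proof.
rewrite mulmx_sumr; apply: big1 => j /eqP mj.
by rewrite fixed_part_mulP mj invr0 scale0r.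
Qed.

Lemma sqnorm_fixed_part l j :
  sqnorm (fixed_part l *m P j) = sqnorm (x *m P j) / modulus l j.
Proof.
have [m0|m0] := eqVneq (modulus l j) 0.
  rewrite fixed_part_mulP m0 invr0 scale0r mulr0.
  by apply/eqP; rewrite sqnorm_eq0.
rewrite fixed_part_mulP sqnormZ; set v := x *m P j.
have vA : (v *m A *m v^T) 0 0 = 0 by rewrite skew_form0// mxE.
have vAT : (v *m (v *m A)^T) 0 0 = 0.
  by rewrite trmx_mul A_skew mulNmx mulmxN mulmxA mxE vA oppr0.
have vAA : sqnorm (v *m A) = alpha j ^+ 2 * sqnorm v.
  rewrite sqnormE trmx_mul A_skew mulNmx mulmxN mulmxA (mulP_sqr A alpha P)//.
  by rewrite -scalemxAl scaleNr opprK mxE -sqnormE.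
rewrite -scaleNr sqnormD !sqnormZ vAA dotZl dotZr vAT.
by field: (sqr_ca l j).
Qed.

(** In complex terms, division by [ca] + i alpha_j [cb] through multiplication by its conjugate over
    the squared modulus. *)
Lemma solve_component l j (v : 'rV[R]_m) : modulus l j != 0 -> v *m P j = v ->
  ca l j *: v + cb l j *: (v *m A) = x *m P j <-> v = fixed_part l *m P j.
Proof.
move=> m0 vP; rewrite fixed_part_mulP.
have vAA : v *m A *m A = - (alpha j ^+ 2) *: v.
  by have := mulP_sqr A alpha P P_sqr v j; rewrite vP.
have xAA := mulP_sqr A alpha P P_sqr x j.
split=> [<-|->].
  rewrite mulmxDl -!scalemxAl vAA; apply/rowP => i.
  by rewrite !mxE; field: (sqr_ca l j).
rewrite -scalemxAl mulmxBl -!scalemxAl xAA; apply/rowP => i.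
by rewrite !mxE; field: (sqr_ca l j).
Qed.

Lemma mulPP (u : 'rV[R]_m) j : u *m P j *m P j = u *m P j.
Proof. by rewrite -mulmxA P_mul eqxx. Qed.

Lemma family_mulP l (u : 'rV[R]_m) j : u - u *m resonant_projector l = fixed_part l ->
  modulus l j != 0 -> u *m P j = fixed_part l *m P j.
Proof.
move=> <- m0; rewrite mulmxBl -mulmxA resonant_projector_mulP (negbTE m0).
by rewrite mulmx0 subr0.
Qed.

Lemma flow_zE (u : 'rV[R]_m) l :
  flow_z alpha P u l 1 = \sum_j area l j * sqnorm (u *m P j).
Proof.
rewrite /flow_z mulr_sumr; apply: eq_bigr => j _.
by rewrite /area !mulr1; ring.
Qed.

(** Non-resonant components of u and of the determined part agree; resonant ones are absent from the
    latter and have weight 1 / (2 l). *)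
Lemma area_diff l (u : 'rV[R]_m) : u - u *m resonant_projector l = fixed_part l ->
  2 * l * (\sum_j area l j * sqnorm (u *m P j) -
           \sum_j area l j * sqnorm (fixed_part l *m P j)) =
  sqnorm (u *m resonant_projector l).
Proof.
move=> ua; rewrite sqnorm_resonant -sumrB mulr_sumr [RHS]big_mkcond.
apply: eq_bigr => j _; case: ifPn => [/eqP mj|mj].
  by rewrite sqnorm_fixed_part mj invr0 !mulr0 subr0 mulrA area_resonant// mul1r.
by rewrite (family_mulP _ _ _ ua mj) subrr mulr0.
Qed.

Lemma radius2P l (u : 'rV[R]_m) : u - u *m resonant_projector l = fixed_part l ->
  \sum_j area l j * sqnorm (u *m P j) = z <->
  sqnorm (u *m resonant_projector l) = radius2 l.
Proof.
move=> ua; rewrite -(area_diff _ _ ua) /radius2; case: eqVneq => [->|l0].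
  rewrite mulr0 mul0r big1// => j _.
  by rewrite /area mul0r sin0 subrr mul0r !mulr0 mul0r.
split=> [-> //|/mulfI H].
apply: (addIr (- \sum_j area l j * sqnorm (fixed_part l *m P j))); apply: H.
by rewrite mulf_neq0 ?pnatr_eq0.
Qed.

Lemma Gamma_family : Gamma A (x, z) = family.
Proof.
apply/seteqP; split=> [[u l]|[u l]];
  rewrite /Gamma /= (exp_mapE A A_skew alpha P)// flow_zE.
  move=> E; have /= Ex := congr1 fst E; have /= Ez := congr1 snd E.
  have xE j : ca l j *: (u *m P j) + cb l j *: (u *m P j *m A) = x *m P j.
    by rewrite -Ex comb_mulP.
  have om : compatible l.
    by move=> j /resonant_coef[c0 c1]; rewrite -xE c0 c1 !scale0r addr0.
  have ua : u - u *m resonant_projector l = fixed_part l.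
    apply: (mulP_eq P P_sum) => j; rewrite mulmxBl -mulmxA resonant_projector_mulP.
    case: ifPn => mj; last first.
      by rewrite mulmx0 subr0; apply/(solve_component _ _ _ mj); rewrite ?mulPP.
    by rewrite subrr fixed_part_mulP (eqP mj) invr0 scale0r.
  by split=> //=; apply/radius2P.
move=> [/= om ua ur]; apply: pair_congr; last exact/radius2P.
apply: (mulP_eq P P_sum) => j; rewrite comb_mulP//.
have [mj|mj] := eqVneq (modulus l j) 0.
  have [c0 c1] := resonant_coef _ _ mj.
  by rewrite -/(ca l j) -/(cb l j) c0 c1 !scale0r addr0 om.
by apply/(solve_component _ _ _ mj); [rewrite mulPP|exact: family_mulP ua mj].
Qed.

(** The indices with x_j = 0 are the resonant ones, by [compatible], and others for which u_j is
    determined and equal to 0. *)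
Lemma Gamma0_family (u : 'rV[R]_m) l : family (u, l) ->
  \sum_(j | x *m P j == 0) sqnorm (u *m P j) = radius2 l.
Proof.
move=> [/= om ua <-]; rewrite sqnorm_resonant big_mkcond [RHS]big_mkcond.
apply: eq_bigr => j _; have [mj|mj] := eqVneq (modulus l j) 0.
  by rewrite om// eqxx.
case: eqP => // xj; rewrite (family_mulP _ _ _ ua mj) sqnorm_fixed_part xj.
by apply/eqP; rewrite mulf_eq0 sqnorm_eq0 eqxx.
Qed.

(** The determined and free parts are orthogonal. With [energyE] this makes the energy a function of
    l alone. *)
Lemma sqnorm_family (u : 'rV[R]_m) l : family (u, l) ->
  sqnorm u = sqnorm (fixed_part l) + radius2 l.
Proof.
move=> [/= _ ua <-]; rewrite -{1}[u](subrK (u *m resonant_projector l)) ua.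
rewrite sqnormD trmx_mul resonant_projector_sym mulmxA fixed_part_resonant.
by rewrite mul0mx mxE mulr0 addr0.
Qed.

(** For x = 0 the squared radius is 2 l z, or z at l = 0, and z <> 0. For x <> 0 some weight c_j is
    positive and compatible levels l <> 0 are admissible, so [finite_slope_sum] applies; l = 0 adds
    at most one level. *)
Lemma finite_zero_radius : (x, z) <> 0 ->
  finite_set [set l | compatible l /\ radius2 l = 0].
Proof.
move=> xz0; pose c j := alpha j / 4 * sqnorm (x *m P j).
have areaE l : l != 0 ->
    \sum_j area l j * sqnorm (fixed_part l *m P j) = slope_sum alpha c l.
  move=> l0; apply: eq_bigr => j _; rewrite sqnorm_fixed_part modulusE//.
  (* At a resonance both sides vanish through division by 0. *)
  rewrite /area /slope /c; have [c1|c1] := eqVneq (cos (l * alpha j)) 1.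
    by rewrite c1 subrr mulr0 mul0r invr0 !mulr0.
  have c1' : 1 - cos (l * alpha j) != 0 by rewrite subr_eq0 eq_sym.
  by field; rewrite ?c1' ?l0 ?gt_eqF.
have [x0|x0] := eqVneq x 0.
  have z0 : z != 0 by apply: contra_not_neq xz0 => ->; rewrite x0.
  rewrite (_ : [set l | _] = set0); first exact: finite_set0.
  apply/seteqP; split=> // l [_ /eqP]; rewrite /radius2.
  have [->|l0] := eqVneq l 0; first by rewrite (negbTE z0).
  rewrite areaE// /slope_sum big1 ?subr0 => [|j _].
    by rewrite mulf_eq0 (negbTE z0) orbF mulf_eq0 pnatr_eq0 (negbTE l0).
  rewrite /c x0 mul0mx (_ : sqnorm 0 = 0) ?mulr0 ?mul0r//.
  by apply/eqP; rewrite sqnorm_eq0.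
have cpos j : 0 <= c j by rewrite !mulr_ge0 ?sqnorm_ge0// ltW.
have c_neq0 j : (c j != 0) = (x *m P j != 0).
  by rewrite !mulf_eq0 (gt_eqF (alpha_gt0 j)) invr_eq0 pnatr_eq0 /= sqnorm_eq0.
have nz : exists j, c j != 0.
  apply: contrapT => all0; case/eqP: x0; apply: (mulP_eq P P_sum) => j.
  rewrite mul0mx; apply/eqP; apply: contrapT => /negP; rewrite -c_neq0 => cj.
  by apply: all0; exists j.
have fin := finite_slope_sum R k alpha c z alpha_gt0 cpos nz.
set F := [set l | _] in fin.
have finF : finite_set (F `|` [set 0]).
  by rewrite finite_setU; split=> //; exact: finite_set1.
apply: sub_finite_set finF => l [om r0]; have [->|l0] := eqVneq l 0; first by right.
left; split=> //; split.
  move=> j; rewrite c_neq0; apply: contra => /eqP c1; apply/eqP/om.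
  exact: cos_eq1_modulus.
move: r0; rewrite /radius2 (negbTE l0) areaE// => /eqP.
rewrite mulf_eq0 mulf_eq0 pnatr_eq0 (negbTE l0) /= subr_eq0.
by move=> /eqP.
Qed.

Lemma finite_bounded_levels (M : R) : (x, z) <> 0 ->
  finite_set ([set l | compatible l /\ (radius2 l = 0 \/ resonant_projector l != 0)]
    `&` [set l | `|l| <= M]).
Proof.
move=> xz0.
have finU := conj (finite_zero_radius xz0) (finite_resonances R k alpha M alpha_gt0).
rewrite -finite_setU in finU; apply: sub_finite_set finU.
move=> l [[om [r0|q0]] lM]; [by left|right; split=> //].
apply: contrapT => nres; case/eqP: q0; apply: big1 => j /eqP/modulus_eq0[_ c1].
by case: nres; exists j.
Qed.

End GammaDescription.

Theorem theorem4 (R : realType) (n : nat) (n_gt0 : (0 < n)%N)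
    (A : 'M[R]_(2 * n)) (A_skew : A^T = - A) (A_nondeg : A \in unitmx)
    (k : nat) (alpha : 'I_k -> R)
    (alpha_incr : forall i j : 'I_k, (i < j)%N -> alpha i < alpha j)
    (alpha_sv : forall a : R, singular_value A a <-> exists j, alpha j = a)
    (p : coords R (2 * n)) (p_neq0 : p <> 0) :
  [/\ Gamma A p = Gamma0 A alpha p `|` Gammaoo A alpha p /\
      Gamma0 A alpha p `&` Gammaoo A alpha p = set0,
      (closed (Gamma0 A alpha p) /\ submanifold (Gamma0 A alpha p)) /\
      (closed (Gammaoo A alpha p) /\ submanifold (Gammaoo A alpha p)),
      finite_set (Gamma0 A alpha p),
      union_of_spheres R (Gammaoo A alpha p) &
      forall eta eta' : coords R (2 * n), Gamma A p eta ->
        connected_component (Gamma A p) eta eta' ->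
        energy (geodesic A eta) = energy (geodesic A eta')].
Proof.
have a0 := alpha_gt0 A A_nondeg alpha alpha_sv.
pose P := sv_projector A alpha.
have Psym : forall j, (P j)^T = P j := sv_projector_sym A alpha.
have Pmul : forall i j, P i *m P j = if i == j then P i else 0 :=
  sv_projectorM A A_nondeg alpha alpha_incr alpha_sv.
have Psum : \sum_j P j = 1%:M := sum_sv_projector A A_nondeg alpha alpha_incr alpha_sv.
have Pcomm : forall j, P j *m A = A *m P j := sv_projectorC A A_skew alpha.
have Psqr : forall j, P j *m A *m A = - (alpha j ^+ 2) *: P j :=
  sv_projector_sqr A A_skew alpha.
case: p p_neq0 => x z xz0.
pose Q := resonant_projector alpha P.
pose a := fixed_part A alpha P x.
pose rho := radius2 A alpha P x z.
pose Om := compatible alpha P x.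
have GE : Gamma A (x, z) = sphere_family Q a rho Om by exact: Gamma_family.
have G0E : Gamma0 A alpha (x, z) = sphere_family0 Q a rho Om.
  have sumE u l : sphere_family Q a rho Om (u, l) ->
      \sum_(j < k | sv_proj A (alpha j) x == 0) sqnorm (sv_proj A (alpha j) u) = rho l.
    exact: Gamma0_family.
  rewrite /Gamma0 GE; apply/seteqP; split=> -[u l] [Fe /= r0]; split=> //=.
    by rewrite -(sumE _ _ Fe).
  by rewrite (sumE _ _ Fe).
have GooE : Gammaoo A alpha (x, z) = sphere_familyoo Q a rho Om.
  rewrite /Gammaoo G0E GE; apply/seteqP; split=> [eta [Fe n0]|eta [Fe /eqP r0]].
    by split=> //; apply/eqP => r0; apply: n0.
  by split=> // -[_ /r0].
have Qsym : forall l, (Q l)^T = Q l by exact: resonant_projector_sym.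
have Qidem : forall l, Q l *m Q l = Q l by exact: resonant_projector_idem.
have aQ : forall l, a l *m Q l = 0 by exact: fixed_part_resonant.
have fin0 : finite_set [set l | Om l /\ rho l = 0] by exact: finite_zero_radius.
have finL M : finite_set
    ([set l | Om l /\ (rho l = 0 \/ Q l != 0)] `&` [set l | `|l| <= M]).
  exact: finite_bounded_levels.
have finG0 : finite_set (Gamma0 A alpha (x, z)).
  by rewrite G0E; exact: finite_sphere_family0.
split.
- rewrite /Gammaoo; split; last by rewrite setDE setICA setICr setI0.
  by rewrite setDUK// => eta [].
- split; first by split; [exact: finite_closed|exact: finite_submanifold].
  rewrite GooE; split; first exact: closed_sphere_familyoo.
  exact: submanifold_sphere_familyoo.
- exact: finG0.
- by rewrite GooE; exact: union_of_spheres_sphere_familyoo.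
(* The level is constant on a component, and |u|^2 has a single value over each level. *)
move=> [u l] [u' l'] Ge; rewrite GE => comp.
have Fe : sphere_family Q a rho Om (u, l) by rewrite -GE.
have Fe' : sphere_family Q a rho Om (u', l') by exact: connected_component_sub comp.
have /= ll := component_sphere_family Q a rho Om finL _ _ comp.
rewrite !(energyE A A_skew alpha P)//.
have sqE v t : sphere_family Q a rho Om (v, t) -> sqnorm v = sqnorm (a t) + rho t.
  exact: sqnorm_family.
by rewrite (sqE _ _ Fe) (sqE _ _ Fe') ll.
Qed.
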